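(* For every formula $\varphi$ of full intuitionistic propositional logic (with $\to,\wedge,\vee,\bot$) one can construct, in logarithmic space, an implicational formula $\psi$ of order at most three such that $\psi$ is intuitionistically provable if and only if $\varphi$ is intuitionistically provable.
   Context: Implicational formulas are built from propositional variables using $\to$ only. Order: an atom has order $0$, and $r(\sigma\to\tau)=\max(r(\tau),r(\sigma)+1)$; equivalently $r(\sigma_1\to\cdots\to\sigma_k\to p)=1+\max_i r(\sigma_i)$ for an atom $p$. *)

(* Defs.v *)
From Stdlib Require PArith List.
From Stdlib Require Import PArith.
From mathcomp Require Import all_boot.
Set Implicit Arguments. Unset Strict Implicit. Unset Printing Implicit Defensive.

Inductive form : Type :=
| Var : nat -> form
| Bot : form
| Imp : form -> form -> form
| And : form -> form -> form
| Or  : form -> form -> form.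

Inductive nd : list form -> form -> Prop :=
| nd_ax   G A : List.In A G -> nd G A
| nd_impI G A B : nd (A :: G) B -> nd G (Imp A B)
| nd_impE G A B : nd G (Imp A B) -> nd G A -> nd G B
| nd_andI G A B : nd G A -> nd G B -> nd G (And A B)
| nd_andE1 G A B : nd G (And A B) -> nd G A
| nd_andE2 G A B : nd G (And A B) -> nd G B
| nd_orI1 G A B : nd G A -> nd G (Or A B)
| nd_orI2 G A B : nd G B -> nd G (Or A B)
| nd_orE  G A B C : nd G (Or A B) -> nd (A :: G) C -> nd (B :: G) C -> nd G C
| nd_botE G A : nd G Bot -> nd G A.

Definition provable (A : form) : Prop := nd nil A.

Inductive iform : Type :=
| IVar : nat -> iform
| IImp : iform -> iform -> iform.

Fixpoint iform_to_form (a : iform) : form :=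
  match a with
  | IVar p => Var p
  | IImp a b => Imp (iform_to_form a) (iform_to_form b)
  end.

Fixpoint iorder (a : iform) : nat :=
  match a with
  | IVar _ => 0
  | IImp s t => maxn (iorder t) (iorder s).+1
  end.

Definition iprovable (a : iform) : Prop := provable (iform_to_form a).

Inductive sym : Type := SImp | SAnd | SOr | SBot | SVar | S0 | S1 | SEnd.

Fixpoint pos_bits (p : positive) : list sym :=
  match p with
  | xH => [:: S1]
  | xO q => pos_bits q ++ [:: S0]
  | xI q => pos_bits q ++ [:: S1]
  end.

Definition nat_bits (n : nat) : list sym :=
  match n with
  | 0 => [:: S0]
  | _ => pos_bits (Pos.of_nat n)
  end.

Fixpoint encode (a : form) : list sym :=
  match a with
  | Var p => SVar :: nat_bits p ++ [:: SEnd]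
  | Bot => [:: SBot]
  | Imp a b => SImp :: encode a ++ encode b
  | And a b => SAnd :: encode a ++ encode b
  | Or a b => SOr :: encode a ++ encode b
  end.

Definition iencode (a : iform) : list sym := encode (iform_to_form a).

(* Deterministic Turing machine with a two-way read-only input tape (with
   endmarkers, read as None), one read/write work tape over a finite work
   alphabet, and a write-only one-way output tape. *)
Inductive move : Type := MLeft | MStay | MRight.

Definition do_move (m : move) (p : nat) : nat :=
  match m with MLeft => p.-1 | MStay => p | MRight => p.+1 end.

Record TM : Type := {
  tm_Q : finType;
  tm_W : finType;
  tm_blank : tm_W;
  tm_q0 : tm_Q;
  tm_halt : pred tm_Q;
  (* state, input symbol, work symbol  |->
     new state, written work symbol, input move, work move, optional output *)
  tm_delta : tm_Q -> option sym -> tm_W ->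
             tm_Q * tm_W * move * move * option sym
}.

Record config (M : TM) : Type := Config {
  c_state : tm_Q M;
  c_ipos : nat;            (* 0 = left endmarker, i = i-th symbol, |w|+1 = right endmarker *)
  c_work : seq (tm_W M);   (* cells beyond the end are blank *)
  c_wpos : nat;
  c_out : seq sym
}.

Definition read_input (w : list sym) (i : nat) : option sym :=
  match i with 0 => None | S j => List.nth_error w j end.

Definition step (M : TM) (w : list sym) (c : config M) : config M :=
  if tm_halt (c_state c) then c else
  let '(q, a, mi, mw, o) :=
      tm_delta (c_state c) (read_input w (c_ipos c))
               (nth (tm_blank M) (c_work c) (c_wpos c)) in
  Config q (minn (do_move mi (c_ipos c)) (size w).+1)
           (set_nth (tm_blank M) (c_work c) (c_wpos c) a)
           (do_move mw (c_wpos c))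
           (c_out c ++ match o with Some s => [:: s] | None => [::] end).

Definition init_config (M : TM) : config M := Config (tm_q0 M) 0 [::] 0 [::].

Definition run (M : TM) (w : list sym) (t : nat) : config M :=
  iter t (step w) (init_config M).

Definition logspace_computes (M : TM) (c : nat) (w y : list sym) : Prop :=
  (exists t, tm_halt (c_state (run M w t)) /\ c_out (run M w t) = y) /\
  (forall t, c_wpos (run M w t) <= c * trunc_log 2 (size w).+2).

Definition logspace_reduction (f : form -> iform) : Prop :=
  exists (M : TM) (c : nat),
    forall phi, logspace_computes M c (encode phi) (iencode (f phi)).

(* Main.v *)
Require Import Defs.
From HB Require Import structures.
From Stdlib Require Import PArith.
From mathcomp Require Import all_boot.
Set Implicit Arguments. Unset Strict Implicit. Unset Printing Implicit Defensive.

(* Every subformula A gets a variable x_A, and every pair of subformulas A, P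
   contributes clauses of order at most two that let x_A behave like A:
   x -> a -> b and (a -> b) -> x for an implication, similarly for a conjunction,
   a -> x, b -> x and x -> (a -> p) -> (b -> p) -> p for a disjunction, x -> p for
   falsity.  The output is "clauses imply x_phi".  Substituting A for x_A makes the
   clauses provable, which gives one direction.  For the other, formulas are
   interpreted over contexts containing the clauses, disjunction and falsity being
   closed under elimination into variables of subformulas; for a subformula A this
   interpretation coincides with derivability of x_A.
   The index of x_A spells the code of A itself in binary, so that printing x_A only
   needs a scan of the occurrence of A in the input, whose end is detected by counting
   pending subformulas.  Hence the clauses can be listed with four binary counters:
   two input positions, a scratch copy, and the number of pending subformulas. *)

(** * Intuitionistic natural deduction *)

Lemma nd_weak G D A : nd G A -> List.incl G D -> nd D A.
Proof.
move=> H; elim: H D => {G A}.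
- by move=> G A inG D sub; apply: nd_ax; apply: sub.
- move=> G A B _ IH D sub; apply: nd_impI; apply: IH => X /= [->|]; first by left.
  by move=> ?; right; apply: sub.
- by move=> G A B _ IH1 _ IH2 D sub; apply: nd_impE (IH1 _ sub) (IH2 _ sub).
- by move=> G A B _ IH1 _ IH2 D sub; apply: nd_andI (IH1 _ sub) (IH2 _ sub).
- by move=> G A B _ IH D sub; apply: nd_andE1 (IH _ sub).
- by move=> G A B _ IH D sub; apply: nd_andE2 (IH _ sub).
- by move=> G A B _ IH D sub; apply: nd_orI1 (IH _ sub).
- by move=> G A B _ IH D sub; apply: nd_orI2 (IH _ sub).
- move=> G A B C _ IH1 _ IH2 _ IH3 D sub.
  by apply: nd_orE (IH1 _ sub) (IH2 _ _) (IH3 _ _) => X /= [->|?];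
    [left | right; apply: sub | left | right; apply: sub].
- by move=> G A _ IH D sub; apply: nd_botE (IH _ sub).
Qed.

Lemma nd_cut G H A : nd G A -> (forall B, List.In B G -> nd H B) -> nd H A.
Proof.
elim: G H A => [|B G IH] H A GA sub; first by apply: nd_weak GA _ => ? [].
apply: nd_impE (sub B _); last by left.
by apply: IH => [|C inC]; [apply: nd_impI | apply: sub; right].
Qed.

Fixpoint subst (s : nat -> form) (A : form) : form :=
  match A with
  | Var p => s p
  | Bot => Bot
  | Imp A B => Imp (subst s A) (subst s B)
  | And A B => And (subst s A) (subst s B)
  | Or A B => Or (subst s A) (subst s B)
  end.

Lemma nd_subst s G A : nd G A -> nd (List.map (subst s) G) (subst s A).
Proof.
elim=> {G A} /= *.
- by apply: nd_ax; apply: List.in_map.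
- exact: nd_impI.
- by apply: nd_impE; eauto.
- exact: nd_andI.
- by apply: nd_andE1; eauto.
- by apply: nd_andE2; eauto.
- exact: nd_orI1.
- exact: nd_orI2.
- by apply: nd_orE; eauto.
- exact: nd_botE.
Qed.

Lemma nd_foldr_imp G Cs A :
  nd G (foldr Imp A Cs) <-> nd (Cs ++ G) A.
Proof.
have mid (C : form) D H : List.incl (D ++ C :: H) (C :: D ++ H) /\ List.incl (C :: D ++ H) (D ++ C
  :: H).
  by split=> X; rewrite /= !List.in_app_iff /=; tauto.
elim: Cs G => [|C Cs IH] G //=; have [s1 s2] := mid C Cs G.
split=> GA.
  apply: nd_weak s1; apply/IH.
  apply: nd_impE (nd_weak GA _) (nd_ax _); last by left.
  by move=> X ?; right.
by apply: nd_impI; apply/IH; exact: nd_weak GA s2.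
Qed.

(** * The reduction *)

(** All codes have length three, so concatenations decode uniquely and the machine can print a code
    symbol by symbol. *)
Definition code (s : sym) : seq bool :=
  match s with
  | SImp => [:: false; false; false]
  | SAnd => [:: false; false; true]
  | SOr => [:: false; true; false]
  | SBot => [:: false; true; true]
  | SVar => [:: true; false; false]
  | S0 => [:: true; false; true]
  | S1 => [:: true; true; false]
  | SEnd => [:: true; true; true]
  end.

Definition bsym (b : bool) : sym := if b then S1 else S0.

(* The leading bit [xH] makes the map from bit strings to numbers injective. *)
Definition name (A : form) : nat :=
  Pos.to_nat (foldl (fun p b => if b then xI p else xO p) xH (flatten (map code (encode A)))).

Lemma pos_bits_foldl p l :
  pos_bits (foldl (fun p b => if b then xI p else xO p) p l) = pos_bits p ++ map bsym l.
Proof.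
elim: l p => [|b l IH] p /=; first by rewrite cats0.
by rewrite IH; case: b => /=; rewrite -catA.
Qed.

Lemma nat_bits_pos p : nat_bits (Pos.to_nat p) = pos_bits p.
Proof.
rewrite /nat_bits; case E: (Pos.to_nat p) => [|m]; last by rewrite -E Pos2Nat.id.
by have [m Em] := Pos2Nat.is_succ p; rewrite Em in E.
Qed.

Lemma nat_bits_name A :
  nat_bits (name A) = S1 :: map bsym (flatten (map code (encode A))).
Proof. by rewrite nat_bits_pos pos_bits_foldl. Qed.

Lemma map_bsym_inj : injective (map bsym).
Proof. by apply: inj_map; case; case. Qed.

Lemma code_inj : injective (fun l => flatten (map code l)).
Proof.
elim=> [|s l IH] [|s' l'] //=; [by case: s'|by case: s|].
move=> E; suff [-> /IH ->] : s = s' /\ flatten (map code l) = flatten (map code l') by [].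
by case: s s' E => [] [] //= [].
Qed.

Lemma pos_bits_inj : injective pos_bits.
Proof.
have nn p : pos_bits p <> [::] by case: p => //= p; case: (pos_bits p).
have one p x : [:: S1] = pos_bits p ++ [:: x] -> False.
  by case E: (pos_bits p) => [|a [|b l]] //; case: (nn p).
elim=> [p IH|p IH|] [q|q|] //=.
- by rewrite !cats1 => /(@rcons_inj _ _ _ _ _)[/IH ->].
- by rewrite !cats1 => /(@rcons_inj _ _ _ _ _)[].
- by move=> /esym/one.
- by rewrite !cats1 => /(@rcons_inj _ _ _ _ _)[].
- by rewrite !cats1 => /(@rcons_inj _ _ _ _ _)[/IH ->].
- by move=> /esym/one.
- by move=> /one.
- by move=> /one.
Qed.

Definition is_bit (s : sym) : bool := match s with S0 | S1 => true | _ => false end.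

Lemma all_bit_nat_bits n : all is_bit (nat_bits n).
Proof.
have H p : all is_bit (pos_bits p) by elim: p => //= p IH; rewrite all_cat IH.
by case: n => [|n] //; apply: H.
Qed.

(** Zero is spelled [[:: S0]], which no positive number is, since its leading bit is [S1]. *)
Lemma nat_bits_inj : injective nat_bits.
Proof.
have no0 p : pos_bits p <> [:: S0].
  elim: p => //= p IH; case E: (pos_bits p) => [|a [|b l]] //.
  by case: p E IH => //= p; case: (pos_bits p).
case=> [|m] [|n] //=; [by move/esym/no0|by move/no0|].
by move=> /pos_bits_inj E; apply: Nat2Pos.inj.
Qed.

Lemma cat_bits_inj l l' r r' : all is_bit l -> all is_bit l' ->
  l ++ SEnd :: r = l' ++ SEnd :: r' -> l = l' /\ r = r'.
Proof.
elim: l l' => [|s l IH] [|s' l'] //=; first by move=> _ _ [].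
- by move=> _ /andP[bs _] [E]; rewrite -E in bs.
- by move=> /andP[bs _] _ [E]; rewrite E in bs.
- by move=> /andP[_ a] /andP[_ a'] [-> /IH[] // -> ->].
Qed.

(** Prefix notation with terminated numerals is prefix-free. The remainders [r] and [r'] let the
    induction pass through two adjacent subformulas. *)
Lemma encode_cat_inj A A' r r' : encode A ++ r = encode A' ++ r' -> A = A' /\ r = r'.
Proof.
elim: A A' r r' => [p||A IHA B IHB|A IHA B IHB|A IHA B IHB]
   [p'||A' B'|A' B'|A' B'] r r' //=.
- rewrite -!catA => -[/cat_bits_inj[]]; try exact: all_bit_nat_bits.
  by move=> /nat_bits_inj -> ->.
- by case.
- by rewrite -!catA => -[/IHA[-> /IHB[-> ->]]].
- by rewrite -!catA => -[/IHA[-> /IHB[-> ->]]].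
- by rewrite -!catA => -[/IHA[-> /IHB[-> ->]]].
Qed.

Lemma name_inj : injective name.
Proof.
move=> A B /(f_equal nat_bits); rewrite !nat_bits_name => -[/map_bsym_inj/code_inj E].
by have [] := @encode_cat_inj A B [::] [::]; rewrite ?cats0.
Qed.

(** Clauses are written as templates over references, so that one finite table [schemas] both
    defines the reduction and drives the machine. *)
Inductive ref := RSelf | RLeft | RRight | RGoal.
Inductive tform := TRef of ref | TImp of tform & tform.

(** The default [Bot] is never looked up by a clause: the schemas for variables and falsity refer to
    no children. *)
Definition left_sub (A : form) : form :=
  match A with Imp B _ | And B _ | Or B _ => B | _ => Bot end.
Definition right_sub (A : form) : form :=
  match A with Imp _ B | And _ B | Or _ B => B | _ => Bot end.

Definition deref (A P : form) (x : ref) : form :=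
  match x with RSelf => A | RLeft => left_sub A | RRight => right_sub A | RGoal => P end.

Fixpoint inst (A P : form) (t : tform) : iform :=
  match t with
  | TRef x => IVar (name (deref A P x))
  | TImp t u => IImp (inst A P t) (inst A P u)
  end.

Definition schemas (s : sym) : seq tform :=
  let x := TRef RSelf in let a := TRef RLeft in let b := TRef RRight in
  let p := TRef RGoal in
  match s with
  | SImp => [:: TImp x (TImp a b); TImp (TImp a b) x]
  | SAnd => [:: TImp x a; TImp x b; TImp a (TImp b x)]
  | SOr => [:: TImp a x; TImp b x; TImp x (TImp (TImp a p) (TImp (TImp b p) p))]
  | SBot => [:: TImp x p]
  | _ => [::]
  end.

Definition clauses_of (A P : form) : seq iform :=
  map (inst A P) (schemas (head SEnd (encode A))).

Fixpoint subs (A : form) : seq form :=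
  A :: match A with
       | Imp B C | And B C | Or B C => subs B ++ subs C
       | _ => [::]
       end.

(** Clauses that do not mention the goal are repeated for every second subformula, which keeps the
    enumeration a plain double loop over the input. *)
Definition clauses (phi : form) : seq iform :=
  flatten (map (fun A => flatten (map (clauses_of A) (subs phi))) (subs phi)).

Definition reduce (phi : form) : iform :=
  foldr IImp (IVar (name phi)) (clauses phi).

Lemma In_flatten_map T U (g : T -> seq U) l y :
  List.In y (flatten (map g l)) <-> exists2 x, List.In x l & List.In y (g x).
Proof.
elim: l => [|x l IH] /=; first by split=> [|[]].
split=> [/(@List.in_app_or _ (g x))[|/IH[z]]|[z [<-|zl] yz]].
- by move=> ?; exists x => //; left.
- by move=> ? ?; exists z => //; right.
- by apply: List.in_or_app; left.
- by apply: List.in_or_app; right; apply/IH; exists z.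
Qed.

Lemma In_clauses phi C : List.In C (clauses phi) <->
  exists A P, [/\ List.In A (subs phi), List.In P (subs phi) & List.In C (clauses_of A P)].
Proof.
rewrite /clauses In_flatten_map; split=> [[A inA /In_flatten_map[P inP inC]]|[A [P [inA inP inC]]]].
  by exists A, P.
by exists A => //; apply/In_flatten_map; exists P.
Qed.

Lemma subs_refl A : List.In A (subs A).
Proof. by case: A => *; left. Qed.

Lemma subs_trans A B C : List.In B (subs A) -> List.In C (subs B) -> List.In C (subs A).
Proof.
have H D E F : List.In B (subs D) \/ List.In B (subs E) ->
   (List.In B (subs D) -> List.In C (subs B) -> List.In C (subs D)) ->
   (List.In B (subs E) -> List.In C (subs B) -> List.In C (subs E)) ->
   List.In C (subs B) -> List.In C (F :: subs D ++ subs E).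
  move=> [i|i] h1 h2 c; right; apply: List.in_or_app; [left|right]; auto.
elim: A => [p||D IHD E IHE|D IHD E IHE|D IHD E IHE] /=;
  try by case=> [<-|[]].
all: by move=> [<- //|/(@List.in_app_or _ (subs D)) i]; apply: H i _ _.
Qed.

(** The highest order among the clauses is two, reached for instance by the premise [a -> p] of a
    disjunction clause; taking clauses as premises adds one. *)
Lemma reduce_order phi : iorder (reduce phi) <= 3.
Proof.
have: forall C, List.In C (clauses phi) -> iorder C <= 2.
  move=> C /In_clauses[A [P [_ _]]].
  by rewrite /clauses_of; case: A => [?||??|??|??] /=; intuition; subst.
rewrite /reduce; elim: (clauses phi) => [|C Cs IH] //= le2.
by rewrite geq_max IH ?ltnS ?le2 //; [left | move=> D ?; apply: le2; right].
Qed.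

Lemma iprovable_reduce phi :
  iprovable (reduce phi) <-> nd (map iform_to_form (clauses phi)) (Var (name phi)).
Proof.
have E : iform_to_form (reduce phi) =
    foldr Imp (Var (name phi)) (map iform_to_form (clauses phi)).
  by rewrite /reduce; elim: (clauses phi) => //= C Cs ->.
by rewrite /iprovable /provable E nd_foldr_imp cats0.
Qed.

Lemma nd_in0 G A : nd (A :: G) A.
Proof. by apply: nd_ax; left. Qed.

Lemma reduce_sound phi : iprovable (reduce phi) -> provable phi.
Proof.
move=> /iprovable_reduce.
(* [s] inverts [name] on the subformulas of [phi]. It sends other variables to [Bot], and none of
   these occurs in a clause. *)
pose s n := nth Bot (subs phi) (find (fun B => name B == n) (subs phi)).
have sE A : List.In A (subs phi) -> s (name A) = A.
  move=> inA; apply: name_inj; apply/eqP.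
  apply: (nth_find Bot (a := fun B => name B == name A)).
  elim: (subs phi) inA => //= B l IH [->|/IH ->]; first by rewrite eqxx.
  by rewrite orbT.
move=> /(nd_subst s) /=; rewrite sE; last exact: subs_refl.
move=> /nd_cut; apply=> B /List.in_map_iff[_ [<- /List.in_map_iff[C [<- ]]]].
move=> /In_clauses[A [P [inA inP]]].
have sl D E : List.In E (subs phi) -> List.In D (subs E) -> s (name D) = D.
  by move=> e d; apply: sE; apply: subs_trans e d.
have sub2 D E F : List.In D (F :: subs D ++ subs E) /\ List.In E (F :: subs D ++ subs E).
  by split; right; apply: List.in_or_app; [left|right]; apply: subs_refl.
rewrite /clauses_of; case: A inA => [?||D E|D E|D E] inA //=.
- case=> // <- /=; rewrite (sE Bot) // sE //.
  by apply: nd_impI; apply: nd_botE; apply: nd_in0.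
- have [d e] := sub2 D E (Imp D E).
  by case=> [<-|[<-|//]] /=; rewrite (sl _ _ inA d) (sl _ _ inA e) (sE _ inA);
     apply: nd_impI; apply: nd_in0.
- have [d e] := sub2 D E (And D E).
  case=> [<-|[<-|[<-|//]]] /=; rewrite ?(sl _ _ inA d) ?(sl _ _ inA e) (sE _ inA).
  + by apply: nd_impI; apply: nd_andE1; apply: nd_in0.
  + by apply: nd_impI; apply: nd_andE2; apply: nd_in0.
  + by do 2 apply: nd_impI; apply: nd_andI; apply: nd_ax; [right; left|left].
- have [d e] := sub2 D E (Or D E).
  case=> [<-|[<-|[<-|//]]] /=; rewrite ?(sl _ _ inA d) ?(sl _ _ inA e) (sE _ inA) ?(sE _ inP).
  + by apply: nd_impI; apply: nd_orI1; apply: nd_in0.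
  + by apply: nd_impI; apply: nd_orI2; apply: nd_in0.
  + do 3 apply: nd_impI; apply: nd_orE.
    * by apply: nd_ax; right; right; left.
    * by apply: nd_impE (nd_in0 _ _); apply: nd_ax; right; right; left.
    * by apply: nd_impE (nd_in0 _ _); apply: nd_ax; right; left.
Qed.

(** * Correctness of the reduction *)

Section Completeness.
Variable phi : form.
Let Gam := map iform_to_form (clauses phi).
Let S A := List.In A (subs phi).
Let prv D A := nd D (Var (name A)).

(* Second-order disjunction elimination, restricted to goals that are variables of
   subformulas, since only those have elimination clauses. *)
Definition closure (X : list form -> Prop) (D : list form) : Prop :=
  forall P, S P -> forall D1, List.incl D D1 ->
    (forall D2, List.incl D1 D2 -> X D2 -> prv D2 P) -> prv D1 P.

(** A Kripke model whose worlds are contexts ordered by inclusion. The guard [S (Var p)] makes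
    [sem_closed] hold also at variables foreign to [phi], through which a derivation of [phi] may
    pass. *)
Fixpoint sem (A : form) (D : list form) : Prop :=
  match A with
  | Var p => S (Var p) -> prv D (Var p)
  | Bot => closure (fun _ => False) D
  | Imp A B => forall D1, List.incl D D1 -> sem A D1 -> sem B D1
  | And A B => sem A D /\ sem B D
  | Or A B => closure (fun D1 => sem A D1 \/ sem B D1) D
  end.

Lemma sem_mono A D D1 : List.incl D D1 -> sem A D -> sem A D1.
Proof.
elim: A D D1 => [p||A IHA B IHB|A IHA B IHB|A IHA B IHB] D D1 sub /=.
- by move=> h i; apply: nd_weak (h i) sub.
- by move=> h P p D2 sub2; apply: h => //; apply: List.incl_tran sub2.
- by move=> h D2 sub2; apply: h; apply: List.incl_tran sub2.
- by move=> [a b]; split; [apply: IHA sub a|apply: IHB sub b].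
- by move=> h P p D2 sub2; apply: h => //; apply: List.incl_tran sub2.
Qed.

(** This makes eliminations sound for goals of any shape although [closure] only has variables as
    goals: a closure is pushed down to the components of implications and conjunctions, and at
    disjunctions and falsity two nested closures collapse into one. *)
Lemma sem_closed A D : closure (sem A) D -> sem A D.
Proof.
elim: A D => [p||A IHA B IHB|A IHA B IHB|A IHA B IHB] D /=.
- move=> h i; apply: h (List.incl_refl _) _ => // D2 _; exact.
- move=> h P p D1 s1 h1; apply: h (s1) _ => // D2 s2 h2.
  exact: h2 (List.incl_refl _) _.
- move=> h D1 s1 a; apply: IHB => P p D2 s2 h2; apply: h => //; first exact: List.incl_tran s2.
  move=> D3 s3 h3; apply: h2 => //; apply: h3; first exact: List.incl_refl.
  by apply: sem_mono a; apply: List.incl_tran s3.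
- move=> h; split; [apply: IHA|apply: IHB] => P p D1 s1 h1; apply: h => // D2 s2 [a b].
  + exact: h1.
  + exact: h1.
- move=> h P p D1 s1 h1; apply: h (s1) _ => // D2 s2 h2.
  apply: h2 (List.incl_refl _) _ => // D3 s3; apply: h1; exact: List.incl_tran s3.
Qed.

Lemma sem_sound G A : nd G A ->
  forall D, (forall B, List.In B G -> sem B D) -> sem A D.
Proof.
elim=> {G A} /=.
- by move=> G A i D; apply.
- move=> G A B _ IH D h D1 s a; apply: IH => C [<- //|i].
  exact: sem_mono s (h _ i).
- by move=> G A B _ IH1 _ IH2 D h; apply: (IH1 _ h _ (List.incl_refl _)); apply: IH2.
- by move=> G A B _ IH1 _ IH2 D h; split; [apply: IH1|apply: IH2].
- by move=> G A B _ IH D h; have [] := IH _ h.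
- by move=> G A B _ IH D h; have [] := IH _ h.
- by move=> G A B _ IH D h P p D1 s; apply=> //; left; apply: sem_mono s (IH _ h).
- by move=> G A B _ IH D h P p D1 s; apply=> //; right; apply: sem_mono s (IH _ h).
- move=> G A B C _ IH1 _ IH2 _ IH3 D h; apply: sem_closed => P p D1 s h1.
  apply: (IH1 _ h) (s) _ => // D2 s2 [a|b]; apply: h1 => //.
    apply: IH2 => E [<- //|/h]; apply: sem_mono; exact: List.incl_tran s2.
  apply: IH3 => E [<- //|/h]; apply: sem_mono; exact: List.incl_tran s2.
- move=> G A _ IH D h; apply: sem_closed => P p D1 s _.
  by apply: (IH _ h) (s) _.
Qed.

Lemma nd_clause A P C D : S A -> S P -> List.In C (clauses_of A P) ->
  List.incl Gam D -> nd D (iform_to_form C).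
Proof.
move=> a p c s; apply: nd_ax; apply: s; apply: List.in_map.
by apply/In_clauses; exists A, P.
Qed.

(** The clauses mirror the cases of [sem]. For disjunction and falsity, left to right takes the
    formula itself as the goal of [closure], while right to left needs an elimination clause for
    every goal [P]. *)
Lemma sem_prv A D : S A -> List.incl Gam D -> sem A D <-> prv D A.
Proof.
elim: A D => [p||A IHA B IHB|A IHA B IHB|A IHA B IHB] D a s /=.
- by split=> h; last move=> _; apply: h.
- split=> [h|h P p D1 s1 _]; first exact: h (List.incl_refl _) _.
  apply: nd_impE (nd_weak h s1).
  apply: (nd_clause (C := IImp (IVar (name Bot)) (IVar (name P))) a p) (List.incl_tran s s1).
  by left.
all: have [sa sb] : S A /\ S B by
  split; apply: subs_trans a _; right; apply: List.in_or_app; [left|right]; apply: subs_refl.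
(* The second disjunct makes the claim total in [n], so clauses can be picked by position; [phi]
   serves as an arbitrary goal. *)
- have cl n : nd D (iform_to_form (nth (IVar 0) (clauses_of (Imp A B) phi) n)) \/ n >= 2.
    case: n => [|[|n]]; [left|left|by right];
      apply: (nd_clause a (subs_refl _)) => //; [by left|by right; left].
  split=> [h|h D1 s1 /IHA h1].
    have [/= c|//] := cl 1; apply: nd_impE c _; apply: nd_impI.
    have s' : List.incl D (Var (name A) :: D) by move=> ?; right.
    have s'' := List.incl_tran s s'.
    by apply/IHB => //; apply: h => //; apply/IHA => //; apply: nd_in0.
  have [/= c|//] := cl 0.
  apply/IHB => //; first exact: List.incl_tran s1.
  apply: nd_impE (nd_impE (nd_weak c s1) (nd_weak h s1)) _.
  by apply: h1 => //; apply: List.incl_tran s1.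
- have cl n : nd D (iform_to_form (nth (IVar 0) (clauses_of (And A B) phi) n)) \/ n >= 3.
    case: n => [|[|[|n]]]; [left|left|left|by right];
      apply: (nd_clause a (subs_refl _)) => //=; by intuition.
  rewrite IHA // IHB //; split=> [[h1 h2]|h].
    have [/= c|//] := cl 2; exact: nd_impE (nd_impE c h1) h2.
  have [/= c1|//] := cl 0; have [/= c2|//] := cl 1.
  by split; [apply: nd_impE c1 h|apply: nd_impE c2 h].
- have cl P D1 : S P -> List.incl D D1 -> forall n,
    nd D1 (iform_to_form (nth (IVar 0) (clauses_of (Or A B) P) n)) \/ n >= 3.
    move=> p s1; case=> [|[|[|n]]]; [left|left|left|by right];
      apply: (nd_clause (C := nth _ _ _) a p) (List.incl_tran s s1) => /=; by intuition.
  split=> [h|h P p D1 s1 h1].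
    (* The closure is used at the goal [Or A B], whose introduction clauses settle both cases. *)
    apply: h (List.incl_refl _) _ => // D2 s2.
    rewrite IHA ?IHB //; try exact: List.incl_tran s2.
    have [/= c1|//] := cl phi D2 (subs_refl _) s2 0.
    have [/= c2|//] := cl phi D2 (subs_refl _) s2 1.
    by case; [apply: nd_impE c1|apply: nd_impE c2].
  have [/= c|//] := cl P D1 p s1 2.
  have ext C : List.incl D1 (C :: D1) by move=> ?; right.
  have ext' C := List.incl_tran s (List.incl_tran s1 (ext C)).
  apply: nd_impE (nd_impE (nd_impE c (nd_weak h s1)) _) _; apply: nd_impI; apply: h1 => //.
    by left; apply/IHA => //; apply: nd_in0.
  by right; apply/IHB => //; apply: nd_in0.
Qed.

Lemma reduce_complete : provable phi -> iprovable (reduce phi).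
Proof.
move=> /sem_sound h; apply/iprovable_reduce.
by apply/sem_prv; [apply: subs_refl|apply: List.incl_refl|apply: h].
Qed.

End Completeness.

(** * A structured language for Turing machines *)

(* [Act] is a single machine step; every command exits with a boolean, which [If] branches
   on and which makes [Loop] repeat its body while it is [true]. *)
Section Commands.
Variables (W : finType) (blank : W).

(** A configuration without its state, hence shared by commands with different state sets. *)
Record tape := Tape { t_ipos : nat; t_work : seq W; t_wpos : nat; t_out : seq sym }.

Definition effect : Type := W * move * move * option sym.

Inductive cmd : Type :=
| Act of (option sym -> W -> bool * effect)
| Seq of cmd & cmd
| If of cmd & cmd & cmd
| Loop of cmd.

Fixpoint states (c : cmd) : finType :=
  match c with
  | Act _ => unit
  | Seq a b => (states a + states b)%type
  | If a b c => (states a + (states b + states c))%type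
  | Loop a => states a
  end.

Fixpoint start (c : cmd) : states c :=
  match c with
  | Act _ => tt
  | Seq a b => inl (start a)
  | If a b c => inl (start a)
  | Loop a => start a
  end.

Definition lift (S T : Type) (f : S -> T) (k : bool -> T + bool) (r : S + bool) : T + bool :=
  match r with inl q => inl (f q) | inr b => k b end.

(** Leaving a subcommand costs no step: the transition that exits it already enters the next one. *)
Fixpoint delta (c : cmd) : states c -> option sym -> W -> (states c + bool) * effect :=
  match c with
  | Act f => fun _ s a => let (b, e) := f s a in (inr b, e)
  | Seq c1 c2 => fun q s a =>
      match q with
      | inl q => let (r, e) := @delta c1 q s a in
                 (lift inl (fun _ => inl (inr (start c2))) r, e)
      | inr q => let (r, e) := @delta c2 q s a in (lift inr inr r, e)
      end
  | If c0 c1 c2 => fun q s a =>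
      match q with
      | inl q => let (r, e) := @delta c0 q s a in
                 (lift inl (fun b => inl (inr (if b then inl (start c1) else inr (start c2)))) r, e)
      | inr (inl q) => let (r, e) := @delta c1 q s a in (lift (fun q => inr (inl q)) inr r, e)
      | inr (inr q) => let (r, e) := @delta c2 q s a in (lift (fun q => inr (inr q)) inr r, e)
      end
  | Loop c1 => fun q s a => let (r, e) := @delta c1 q s a in
      (lift id (fun b => if b then inl (start c1) else inr false) r, e)
  end.

Definition machine (c : cmd) : TM :=
  @Build_TM (states c + bool)%type W blank (inl (start c))
    (fun q => if q is inr _ then true else false)
    (fun q s a => match q with
       | inl q => let '(r, (b, mi, mw, o)) := delta q s a in (r, b, mi, mw, o)
       | inr b => (inr b, a, MStay, MStay, None)
       end).

Variables (w : seq sym) (B : nat).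

Definition apply_effect (e : effect) (t : tape) : tape :=
  let '(a, mi, mw, o) := e in
  Tape (minn (do_move mi (t_ipos t)) (size w).+1)
       (set_nth blank (t_work t) (t_wpos t) a)
       (do_move mw (t_wpos t))
       (t_out t ++ match o with Some s => [:: s] | None => [::] end).

Definition scanned (t : tape) : W := nth blank (t_work t) (t_wpos t).

(** Big-step semantics. The bound [B] is checked at every single action, so an execution carries the
    space bound for all intermediate tapes. *)
Inductive exec : cmd -> tape -> bool -> tape -> Prop :=
| exec_act f t b e : f (read_input w (t_ipos t)) (scanned t) = (b, e) ->
    t_wpos t <= B -> t_wpos (apply_effect e t) <= B -> exec (Act f) t b (apply_effect e t)
| exec_seq c1 c2 t b1 t1 b2 t2 :
    exec c1 t b1 t1 -> exec c2 t1 b2 t2 -> exec (Seq c1 c2) t b2 t2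
| exec_if c c1 c2 t b t1 b2 t2 :
    exec c t b t1 -> exec (if b then c1 else c2) t1 b2 t2 -> exec (If c c1 c2) t b2 t2
| exec_loop_end c t t1 : exec c t false t1 -> exec (Loop c) t false t1
| exec_loop_step c t t1 b t2 :
    exec c t true t1 -> exec (Loop c) t1 b t2 -> exec (Loop c) t b t2.

Inductive reach (c : cmd) : states c + bool -> tape -> states c + bool -> tape -> Prop :=
| reach_refl x t : reach x t x t
| reach_step q t r e z t' : t_wpos t <= B ->
    delta q (read_input w (t_ipos t)) (scanned t) = (r, e) ->
    reach r (apply_effect e t) z t' -> reach (inl q) t z t'.

Lemma reach_trans c x t y u z v : @reach c x t y u -> reach y u z v -> reach x t z v.
Proof.
move=> h; elim: h z v => // q s r e y' t' le dE _ IH z v /IH h.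
exact: reach_step dE h.
Qed.

(** A run of a subcommand is a run of the whole, with states embedded by [f] and exits rerouted by
    [k]. Sequencing, branching and looping are all instances. *)
Lemma reach_lift c c' (f : states c -> states c') (k : bool -> states c' + bool) :
  (forall q s a, delta (f q) s a = let (r, e) := delta q s a in (lift f k r, e)) ->
  forall x t y u, reach x t y u -> reach (lift f k x) t (lift f k y) u.
Proof.
move=> fE x t y u; elim=> [z v|q v r e z v' le dE _ IH]; first exact: reach_refl.
by apply: reach_step IH => //; rewrite fE dE.
Qed.

Lemma exec_reach c t b u : exec c t b u -> reach (inl (start c)) t (inr b) u.
Proof.
elim=> {c t b u}.
- move=> f t b e fE le1 le2; apply: reach_step (reach_refl _ _) => //=.
  by rewrite fE.
- move=> c1 c2 t b1 t1 b2 t2 _ IH1 _ IH2.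
  apply: reach_trans (@reach_lift _ (Seq c1 c2) inl (fun _ => inl (inr (start c2))) _ _ _ _ _ IH1)
    _ => //.
  exact: (@reach_lift _ (Seq c1 c2) inr inr _ _ _ _ _ IH2).
- move=> c c1 c2 t b t1 b2 t2 _ IH1 _ IH2.
  apply: reach_trans (@reach_lift _ (If c c1 c2) inl
    (fun b => inl (inr (if b then inl (start c1) else inr (start c2)))) _ _ _ _ _ IH1) _ => //=.
  case: b IH1 IH2 => _ IH2.
    exact: (@reach_lift _ (If c c1 c2) (fun q => inr (inl q)) inr _ _ _ _ _ IH2).
  exact: (@reach_lift _ (If c c1 c2) (fun q => inr (inr q)) inr _ _ _ _ _ IH2).
- move=> c t t1 _ IH.
  exact: (@reach_lift c (Loop c) id (fun b => if b then inl (start c) else inr false) (fun _ _ _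
    => erefl) _ _ _ _ IH).
- move=> c t t1 b t2 _ IH1 _ IH2; apply: reach_trans IH2.
  exact: (@reach_lift c (Loop c) id (fun b => if b then inl (start c) else inr false) (fun _ _ _
    => erefl) _ _ _ _ IH1).
Qed.

Lemma exec_wpos c t b u : exec c t b u -> t_wpos u <= B.
Proof. by elim. Qed.

Definition config_of c (x : states c + bool) (t : tape) : config (machine c) :=
  @Config (machine c) x (t_ipos t) (t_work t) (t_wpos t) (t_out t).

Lemma reach_iter c x t b u : @reach c x t (inr b) u -> t_wpos u <= B ->
  exists2 n, iter n (step w) (config_of x t) = config_of (inr b) u &
    forall m, c_wpos (iter m (step w) (config_of x t)) <= B.
Proof.
move E: (inr b) => y h le; elim: h E le => {x t y u} [x t <- le|q t r e z t' le dE _ IH zE le'].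
  (* A halted configuration is fixed by [step], so the bound extends to all later times. *)
  by exists 0 => // m; rewrite iter_fix.
have [n nE bd] := IH zE le'.
have sE : step w (config_of (inl q) t) = config_of r (apply_effect e t).
  case: e dE {IH nE bd} => [[[a mi] mw] o] dE.
  by rewrite /step /= -/(scanned t) dE.
exists n.+1; first by rewrite iterSr sE.
by case=> // m; rewrite iterSr sE.
Qed.

Lemma exec_computes c b u : exec c (Tape 0 [::] 0 [::]) b u ->
  (exists t, tm_halt (c_state (run (machine c) w t)) /\ c_out (run (machine c) w t) = t_out u) /\
  (forall t, c_wpos (run (machine c) w t) <= B).
Proof.
move=> h; have [n nE bd] := reach_iter (exec_reach h) (exec_wpos h).
by split=> //; exists n; rewrite /run [iter _ _ _]nE.
Qed.

(** A total-correctness Hoare triple that also fixes the exit bit and includes the space bound. *)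
Definition triple (P : tape -> Prop) (c : cmd) (b : bool) (Q : tape -> Prop) : Prop :=
  forall t, P t -> exists2 u, exec c t b u & Q u.

Lemma tr_seq P c1 b1 Q c2 b R :
  triple P c1 b1 Q -> triple Q c2 b R -> triple P (Seq c1 c2) b R.
Proof. by move=> h1 h2 t /h1[u e1 /h2[v e2 r]]; exists v => //; apply: exec_seq e1 e2. Qed.

Lemma tr_if P c b0 Q c1 c2 b R :
  triple P c b0 Q -> triple Q (if b0 then c1 else c2) b R -> triple P (If c c1 c2) b R.
Proof. by move=> h1 h2 t /h1[u e1 /h2[v e2 r]]; exists v => //; apply: exec_if e1 e2. Qed.

Lemma tr_loop_end P c Q : triple P c false Q -> triple P (Loop c) false Q.
Proof. by move=> h t /h[u e q]; exists u => //; apply: exec_loop_end. Qed.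

Lemma tr_loop_step P c Q b R :
  triple P c true Q -> triple Q (Loop c) b R -> triple P (Loop c) b R.
Proof. by move=> h1 h2 t /h1[u e1 /h2[v e2 r]]; exists v => //; apply: exec_loop_step e1 e2. Qed.

Lemma tr_weak P P' c b Q Q' : triple P c b Q ->
  (forall t, P' t -> P t) -> (forall t, Q t -> Q' t) -> triple P' c b Q'.
Proof. by move=> h pp qq t /pp/h[u e /qq]; exists u. Qed.

End Commands.

(** * Binary counters on the work tape *)

Fixpoint bval (s : seq bool) : nat := if s is b :: s' then b + (bval s').*2 else 0.
Fixpoint binc (s : seq bool) : seq bool :=
  match s with
  | [::] => [:: true]
  | true :: s => false :: binc s
  | false :: s => true :: s
  end.
(** The length is kept, so numerals may carry zeros at their most significant end. *)
Fixpoint bdec (s : seq bool) : seq bool :=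
  match s with
  | [::] => [::]
  | true :: s => false :: s
  | false :: s => true :: bdec s
  end.

Lemma bval_binc s : bval (binc s) = (bval s).+1.
Proof. by elim: s => //= -[] s IH //=; rewrite IH doubleS. Qed.

Lemma bval_bdec s : bval s > 0 -> bval (bdec s) = (bval s).-1.
Proof.
elim: s => //= -[] s IH //=; rewrite !add0n double_gt0 => h; rewrite IH //.
by case: (bval s) h.
Qed.

Lemma size_bdec s : size (bdec s) = size s.
Proof. by elim: s => //= -[] s //= ->. Qed.

(** A numeral grows only when all its bits are [true], and then the incremented value is 2 to the
    power of its old length. *)
Lemma size_binc s n : size s <= n -> (bval s).+1 < 2 ^ n -> size (binc s) <= n.
Proof.
elim: s n => [|[] s IH] [|n] //= le lt; rewrite ltnS IH //.
by move: lt; rewrite add1n -doubleS expnS mul2n ltn_double.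
Qed.

(* The work tape has one track per counter, least significant bit first, [None] marking
   the end of the number; cell 0 carries a [true] flag so that the head can find it. *)
Section Tracks.
Variable K : finType.

Definition cell : Type := (bool * {ffun K -> option bool})%type.
HB.instance Definition _ := Finite.on cell.
Definition blank_cell : cell := (false, [ffun=> None]).
Definition write_bit (a : cell) (k : K) (v : bool) : cell :=
  (a.1, [ffun j => if j == k then Some v else a.2 j]).
Definition layout (L : K -> seq bool) (i : nat) : cell := (i == 0, [ffun k => onth (L k) i]).
Definition upd (T : Type) (L : K -> T) (k : K) (s : T) : K -> T :=
  fun j => if j == k then s else L j.

Variables (w : seq sym) (B : nat).
Notation tr := (triple blank_cell w B).
Notation tape := (tape cell).

(** Tapes are compared cell by cell, because lists that differ in trailing blanks represent the same
    tape. *)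
Definition at_cell (p : nat) (L : K -> seq bool) (m : nat) (o : seq sym) (t : tape) : Prop :=
  [/\ t_ipos t = p, (forall i, nth blank_cell (t_work t) i = layout L i),
      t_wpos t = m & t_out t = o].

Lemma at_cell_ext p L L' m o t : L =1 L' -> at_cell p L m o t -> at_cell p L' m o t.
Proof.
move=> LL [? h ? ?]; split=> // i; rewrite h /layout; congr pair.
by apply/ffunP => k; rewrite !ffunE LL.
Qed.

Lemma tr_act f p L m o b a mi mw out L' :
  f (read_input w p) (layout L m) = (b, (a, mi, mw, out)) ->
  layout L' m = a -> (forall i, i != m -> layout L' i = layout L i) ->
  m <= B -> do_move mw m <= B ->
  tr (at_cell p L m o) (Act f) b
     (at_cell (minn (do_move mi p) (size w).+1) L' (do_move mw m)
        (o ++ match out with Some s => [:: s] | None => [::] end)).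
Proof.
move=> fE L'm L'i le1 le2 [p' wk m' o'] [/= -> hL -> ->].
exists (apply_effect blank_cell w (a, mi, mw, out) (Tape p wk m o)).
  by apply: exec_act => //=; rewrite /scanned /= hL.
split=> //= i; rewrite nth_set_nth /=; case: eqP => [->|/eqP ne] //.
by rewrite hL L'i.
Qed.

Lemma tr_act_work f p L m o b a mw L' :
  f (read_input w p) (layout L m) = (b, (a, MStay, mw, None)) ->
  layout L' m = a -> (forall i, i != m -> layout L' i = layout L i) ->
  p <= (size w).+1 -> m <= B -> do_move mw m <= B ->
  tr (at_cell p L m o) (Act f) b (at_cell p L' (do_move mw m) o).
Proof.
move=> fE L'm L'i lep le1 le2; have := @tr_act _ _ _ _ o _ _ _ _ _ _ fE L'm L'i le1 le2.
by rewrite /= (minn_idPl lep) cats0.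
Qed.

Definition rewind_work : cmd cell :=
  Loop (Act (fun _ (a : cell) => if a.1 then (false, (a, MStay, MStay, None))
                                 else (true, (a, MStay, MLeft, None)))).

Lemma rewind_workP p L m o : p <= (size w).+1 -> m <= B ->
  tr (at_cell p L m o) rewind_work false (at_cell p L 0 o).
Proof.
move=> lep; elim: m => [|m IH] le.
  by apply: tr_loop_end; apply: (tr_act_work (mw := MStay) (a := layout L 0)).
apply: tr_loop_step (IH (ltnW le)).
by apply: (tr_act_work (mw := MLeft) (a := layout L m.+1)) => //; apply: ltnW.
Qed.

(* Binary increment, decrement and zero test all replace a prefix of equal bits [b] by [v1]
   and then write [v2] (if any) on the first other cell. *)
Definition scan (k : K) (b v1 : bool) (v2 : option bool) : cmd cell :=
  Loop (Act (fun _ (a : cell) =>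
    if a.2 k == Some b then (true, (write_bit a k v1, MStay, MRight, None))
    else (false, (if v2 is Some v then write_bit a k v else a, MStay, MStay, None)))).

Fixpoint scan_bits (b v1 : bool) (v2 : option bool) (s : seq bool) : seq bool :=
  match s with
  | x :: s' => if x == b then v1 :: scan_bits b v1 v2 s'
               else if v2 is Some v then v :: s' else s
  | [::] => if v2 is Some v then [:: v] else [::]
  end.

(** Writing just after [pre] replaces the first bit of [r], or lengthens the numeral when [r] is
    empty; [behead] covers both cases. *)
Lemma layout_upd L k pre v r i : L k = pre ++ r ->
  layout (upd L k (pre ++ v :: behead r)) i =
  if i == size pre then write_bit (layout L (size pre)) k v else layout L i.
Proof.
move=> Lk; rewrite /layout /write_bit /=; have [->|ne] := eqVneq i (size pre);
  congr pair; apply/ffunP => j; rewrite !ffunE /upd.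
  have [E|ne] := eqVneq j k; last by rewrite ?(negPf ne).
  by rewrite ?E onth_cat ltnn subnn.
have [E|ne'] := eqVneq j k; last by rewrite ?(negPf ne').
rewrite ?E Lk !onth_cat; case: ltnP => // ni.
have: i - size pre > 0 by rewrite subn_gt0 ltn_neqAle eq_sym ne.
by case: (i - size pre) => // d _; case: r {Lk} => //; case: d.
Qed.

Lemma layout_same L k s i : L k = s -> layout (upd L k s) i = layout L i.
Proof.
move=> Lk; rewrite /layout; congr pair; apply/ffunP => j; rewrite !ffunE /upd.
by case: (j =P k) => // ->; rewrite Lk.
Qed.

Lemma scan_bits_stop b v1 v2 s : ohead s != Some b ->
  scan_bits b v1 v2 s = if v2 is Some v then v :: behead s else s.
Proof.
case: s => //= x s hd; have [E|_] := eqVneq x b; first by rewrite E eqxx in hd.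
by case: v2.
Qed.

Lemma scan_stop p k b v1 v2 pre s L o : p <= (size w).+1 -> size pre + size s <= B ->
  L k = pre ++ s -> ohead s != Some b ->
  tr (at_cell p L (size pre) o) (scan k b v1 v2) false
     (at_cell p (upd L k (pre ++ scan_bits b v1 v2 s)) (size pre) o).
Proof.
move=> lep le Lk hd; apply: tr_loop_end.
have le' := leq_trans (leq_addr _ _) le.
apply: (@tr_act_work _ p L (size pre) o false
  (if v2 is Some v then write_bit (layout L (size pre)) k v else layout L (size pre)) MStay) => //=.
- rewrite ffunE Lk onth_cat ltnn subnn.
  by have -> : onth s 0 = ohead s; [case: s {le Lk hd}|rewrite (negPf hd)].
- case: v2 => [v|].
    by rewrite scan_bits_stop // layout_upd // eqxx.
  by rewrite scan_bits_stop // layout_same.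
- move=> i ne; case: v2 => [v|].
    by rewrite scan_bits_stop // layout_upd // (negPf ne).
  by rewrite scan_bits_stop // layout_same.
Qed.

Lemma scanP p k b v1 v2 pre s L o : p <= (size w).+1 -> size pre + size s <= B ->
  L k = pre ++ s ->
  tr (at_cell p L (size pre) o) (scan k b v1 v2) false
     (at_cell p (upd L k (pre ++ scan_bits b v1 v2 s)) (size pre + find (predC1 b) s) o).
Proof.
move=> lep; elim: s pre L => [|x s IH] pre L le Lk.
  by rewrite addn0; apply: scan_stop.
have [xb|xb] := eqVneq x b; last first.
  have -> : find (predC1 b) (x :: s) = 0 by rewrite /= xb.
  by rewrite addn0; apply: scan_stop => //=; apply: contraNneq xb => -[->].
rewrite /= xb /= eqxx /= addnS -addSn.
(* The tracks after one round; the scanned bit has moved into the prefix. *)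
pose L1 := upd L k (rcons pre v1 ++ s).
have L1k : L1 k = rcons pre v1 ++ s by rewrite /L1 /upd eqxx.
have := IH (rcons pre v1) L1; rewrite L1k size_rcons addSnnS => /(_ le erefl) {}IH.
apply: (@tr_loop_step _ _ _ _ _ _ (at_cell p L1 (size pre).+1 o)); last first.
  apply: tr_weak IH _ _ => // t; rewrite -cats1 -catA; apply: at_cell_ext => j.
  by rewrite /L1 /upd; case: eqP.
have lt : size pre < B by apply: leq_trans le; rewrite /= addnS ltnS leq_addr.
apply: (@tr_act_work _ p L (size pre) o true (write_bit (layout L (size pre)) k v1) MRight) => //=.
- by rewrite ffunE Lk onth_cat ltnn subnn /= xb eqxx.
- by rewrite /L1 cat_rcons -[s]/(behead (x :: s)) layout_upd // eqxx.
- by move=> i ne; rewrite /L1 cat_rcons -[s]/(behead (x :: s)) layout_upd // (negPf ne).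
- exact: ltnW.
Qed.

Lemma binc_scan s : binc s = scan_bits true false (Some true) s.
Proof. by elim: s => //= -[] s IH //=; rewrite IH. Qed.

(** Positivity ensures that the scan meets a [true] bit and does not write past the end. *)
Lemma bdec_scan s : bval s > 0 -> bdec s = scan_bits false true (Some false) s.
Proof. by elim: s => //= -[] s IH //=; rewrite add0n double_gt0 => /IH ->. Qed.

Lemma test_scan s : scan_bits false false None s = s.
Proof. by elim: s => //= -[] s //= ->. Qed.

(** Numerals are hidden behind their values; of their shape only the length bound survives. *)
Definition at_regs (p : nat) (r : K -> nat) (o : seq sym) (t : tape) : Prop :=
  exists L, at_cell p L 0 o t /\ forall k, bval (L k) = r k /\ size (L k) <= B.

Definition ret (b : bool) : cmd cell := Act (fun _ a => (b, (a, MStay, MStay, None))).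

Definition inc (k : K) : cmd cell := Seq (scan k true false (Some true)) rewind_work.
Definition dec (k : K) : cmd cell := Seq (scan k false true (Some false)) rewind_work.
(** This scan changes nothing and stops on a [true] bit exactly when the value is positive. The two
    branches keep the answer in the state while the head returns. *)
Definition nonzero (k : K) : cmd cell :=
  Seq (scan k false false None)
    (If (Act (fun _ (a : cell) => (a.2 k == Some true, (a, MStay, MStay, None))))
       (Seq rewind_work (ret true)) (Seq rewind_work (ret false))).

Lemma at_regs_ext p r r' o t : r =1 r' -> at_regs p r o t -> at_regs p r' o t.
Proof. by move=> rr [L [h1 h2]]; exists L; split=> // k; rewrite -rr. Qed.

Lemma scan_regsP p r k b v1 v2 n o : p <= (size w).+1 ->
  (forall s, bval s = r k -> size s <= B ->
     bval (scan_bits b v1 v2 s) = n /\ size (scan_bits b v1 v2 s) <= B) ->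
  tr (at_regs p r o) (Seq (scan k b v1 v2) rewind_work) false (at_regs p (upd r k n) o).
Proof.
move=> lep hs t [L [h1 h2]]; have [v sz] := h2 k; have [v' sz'] := hs _ v sz.
have lem : size (nil : seq bool) + find (predC1 b) (L k) <= B.
  exact: leq_trans (find_size _ _) sz.
have [u e hu] := tr_seq (@scanP p k b v1 v2 [::] (L k) L o lep sz erefl)
  (rewind_workP lep lem) h1.
exists u => //; exists (upd L k (scan_bits b v1 v2 (L k))); split=> // j.
by rewrite /upd; case: eqP.
Qed.

Lemma inc_regP p r k o : p <= (size w).+1 -> (r k).+1 < 2 ^ B ->
  tr (at_regs p r o) (inc k) false (at_regs p (upd r k (r k).+1) o).
Proof.
move=> lep lt; apply: scan_regsP => // s v sz.
by rewrite -binc_scan bval_binc v; split=> //; apply: size_binc; rewrite ?v.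
Qed.

Lemma dec_regP p r k o : p <= (size w).+1 -> 0 < r k ->
  tr (at_regs p r o) (dec k) false (at_regs p (upd r k (r k).-1) o).
Proof.
move=> lep gt0; apply: scan_regsP => // s v sz.
by rewrite -bdec_scan ?v // bval_bdec ?v // size_bdec.
Qed.

Lemma bval_find s : (onth s (find (predC1 false) s) == Some true) = (0 < bval s).
Proof. by elim: s => //= -[] s IH //=; rewrite IH add0n double_gt0. Qed.

Lemma at_cell_act f p L m o b : p <= (size w).+1 -> m <= B ->
  f (read_input w p) (layout L m) = (b, (layout L m, MStay, MStay, None)) ->
  tr (at_cell p L m o) (Act f) b (at_cell p L m o).
Proof. by move=> lep le fE; apply: (tr_act_work (mw := MStay)) fE _ _ _ _ _. Qed.

Lemma nonzeroP p r k o : p <= (size w).+1 ->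
  tr (at_regs p r o) (nonzero k) (0 < r k) (at_regs p r o).
Proof.
move=> lep t [L [h1 h2]]; have [v sz] := h2 k.
have lem : size (nil : seq bool) + find (predC1 false) (L k) <= B.
  exact: leq_trans (find_size _ _) sz.
have LE : upd L k ([::] ++ scan_bits false false None (L k)) =1 L.
  by move=> j; rewrite test_scan /upd; case: (j =P k) => //= ->.
have {h1} [u e hu] : exists2 u, exec blank_cell w B (nonzero k) t (0 < r k) u & at_cell p L 0 o u;
  last by exists u => //; exists L.
move: t h1; apply: tr_seq (tr_weak (@scanP p k false false None [::] (L k) L o lep sz erefl)
  (fun t h => h) (fun t => at_cell_ext LE)) _.
apply: (@tr_if _ _ _ _ _ _ (0 < r k)).
  apply: at_cell_act => //=.
  by rewrite ffunE bval_find v.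
have ret_tr b : tr (at_cell p L (size (nil : seq bool) + find (predC1 false) (L k)) o)
    (Seq rewind_work (ret b)) b (at_cell p L 0 o).
  by apply: tr_seq (rewind_workP lep lem) (at_cell_act _ _ _).
by case: (0 < r k); apply: ret_tr.
Qed.

Definition input_act (g : option sym -> bool * move * option sym) : cmd cell :=
  Act (fun s a => let '(b, m, o) := g s in (b, (a, m, MStay, o))).

Lemma input_actP g p r o b m x : g (read_input w p) = (b, m, x) ->
  tr (at_regs p r o) (input_act g) b
    (at_regs (minn (do_move m p) (size w).+1) r
       (o ++ match x with Some s => [:: s] | None => [::] end)).
Proof.
move=> gE t [L [h1 h2]].
pose f s a := let '(b, m, o) := g s in (b, (a : cell, m, MStay, o)).
have fE : f (read_input w p) (layout L 0) = (b, (layout L 0, m, MStay, x)) by rewrite /f gE.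
have [u e hu] := tr_act fE erefl (fun _ _ => erefl) (leq0n _) (leq0n _) h1.
by exists u => //; exists L.
Qed.

Definition mark : cmd cell :=
  Act (fun _ _ => (false, ((true, [ffun=> None]), MStay, MStay, None))).

(** Empty numerals have value zero, so flagging cell 0 initializes all counters at once. *)
Lemma markP : tr (eq (Tape 0 [::] 0 [::])) mark false (at_regs 0 (fun=> 0) [::]).
Proof.
move=> _ <-; set u := apply_effect blank_cell w ((true, [ffun=> None]), MStay, MStay, None)
   (Tape 0 [::] 0 [::]).
exists u; first exact: exec_act.
exists (fun=> [::]); split=> //; split=> // i; rewrite /u /=.
by case: i => [|i]; rewrite /layout /= ?nth_nil; congr pair; apply/ffunP => k; rewrite !ffunE.
Qed.

End Tracks.

(** * The machine *)

Definition reg : finType := (bool * bool)%type.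
Definition ptr (b : bool) : reg := (false, b).
Definition tmp : reg := (true, false).
Definition depth : reg := (true, true).

(* [regs b x y t d]: the pointer named [b] holds [x], the other pointer [y]. *)
Definition regs (b : bool) (x y t d : nat) : reg -> nat :=
  fun k => match k with
           | (false, b') => if b' == b then x else y
           | (true, false) => t
           | (true, true) => d
           end.

Lemma regs_ptr b x y t d : regs b x y t d (ptr b) = x.
Proof. by rewrite /= eqxx. Qed.

Lemma upd_ptr b x y t d v : upd (regs b x y t d) (ptr b) v =1 regs b v y t d.
Proof. by move=> [[] []]; rewrite /upd /=; case: b. Qed.

Lemma upd_tmp b x y t d v : upd (regs b x y t d) tmp v =1 regs b x y v d.
Proof. by move=> [[] []]. Qed.

Lemma upd_depth b x y t d v : upd (regs b x y t d) depth v =1 regs b x y t v.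
Proof. by move=> [[] []]. Qed.

Notation prog := (cmd (cell reg)).

Definition While (k : reg) (c : prog) : prog :=
  Loop (If (nonzero k) (Seq c (ret _ true)) (ret _ false)).

Definition go_left : prog := input_act _ (fun _ => (false, MLeft, None)).
Definition go_right : prog := input_act _ (fun _ => (false, MRight, None)).
Definition out (s : sym) : prog := input_act _ (fun _ => (false, MStay, Some s)).
Definition test (f : option sym -> bool) : prog := input_act _ (fun s => (f s, MStay, None)).
Definition on_sym (f : sym -> bool) (s : option sym) : bool := if s is Some x then f x else false.

(** The move precedes the test because both endmarkers read as [None], and the head may start on the
    right one. *)
Definition rewind_input : prog := Loop (Seq go_left (test (fun s => isSome s))).

(** Counting the pointer down destroys it; the copy collected in [tmp] restores it. *)
Definition goto (b : bool) : prog :=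
  Seq rewind_input
    (Seq (While (ptr b) (Seq (dec (ptr b)) (Seq (inc tmp) go_right)))
         (While tmp (Seq (dec tmp) (inc (ptr b))))).

Definition is_binary (s : sym) : bool :=
  match s with SImp | SAnd | SOr => true | _ => false end.
(** A variable is complete only at its [SEnd], so [SVar] and the bits leave the number of pending
    subformulas unchanged. *)
Definition is_leaf (s : sym) : bool :=
  match s with SBot | SEnd => true | _ => false end.
Definition is_start (s : sym) : bool :=
  match s with S0 | S1 | SEnd => false | _ => true end.

Definition out_code (i : nat) : prog := input_act _ (fun s =>
  (false, MStay, Some (bsym (nth false (if s is Some x then code x else [::]) i)))).

Definition visit (print : bool) : prog :=
  Seq (if print then Seq (out_code 0) (Seq (out_code 1) (out_code 2)) else ret _ false)
    (Seq (If (test (on_sym is_binary)) (inc depth) (ret _ false))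
      (Seq (If (test (on_sym is_leaf)) (dec depth) (ret _ false)) go_right)).

(** Serves both to print a subformula and to skip it: a right child starts where the scan of the
    left child stops. *)
Definition traverse (print : bool) : prog := Seq (inc depth) (While depth (visit print)).

Definition locate (x : ref) : prog :=
  match x with
  | RSelf => goto false
  | RLeft => Seq (goto false) go_right
  | RRight => Seq (goto false) (Seq go_right (traverse false))
  | RGoal => goto true
  end.

(** The [S1] is the leading bit of the name, as in [nat_bits_name]. *)
Definition emit_ref (x : ref) : prog :=
  Seq (locate x) (Seq (out SVar) (Seq (out S1) (Seq (traverse true) (out SEnd)))).

Fixpoint emit (t : tform) : prog :=
  match t with
  | TRef x => emit_ref x
  | TImp t u => Seq (out SImp) (Seq (emit t) (emit u))
  end.

Definition emit_schemas (ts : seq tform) : prog :=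
  foldr (fun t c => Seq (out SImp) (Seq (emit t) c)) (ret _ false) ts.

(** The head returns to the first pointer before each test, since an earlier [emit_if] may have
    moved it. Symbols are compared through their codes. *)
Definition emit_if (s : sym) : prog :=
  Seq (goto false) (If (test (on_sym (fun x => code x == code s)))
                       (emit_schemas (schemas s)) (ret _ false)).

(** Only the second pointer is tested for a start: where the first one starts no subformula, none of
    the four [emit_if] fires. *)
Definition emit_pair : prog :=
  Seq (goto true) (If (test (on_sym is_start))
    (Seq (emit_if SImp) (Seq (emit_if SAnd) (Seq (emit_if SOr) (emit_if SBot))))
    (ret _ false)).

(** Position 0 is the left endmarker, so counting starts at 1; the right endmarker ends the loop.
    Clearing the pointer lets an inner loop start afresh in each outer round. *)
Definition For (b : bool) (c : prog) : prog :=
  Seq (inc (ptr b))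
    (Seq (Loop (Seq (goto b)
           (If (test (fun s => isSome s)) (Seq c (Seq (inc (ptr b)) (ret _ true))) (ret _ false))))
         (While (ptr b) (dec (ptr b)))).

(** The code of the whole input formula starts at position 1, so the last command prints the
    conclusion. *)
Definition main : prog :=
  Seq (mark _) (Seq (For false (For true emit_pair))
    (Seq (inc (ptr false)) (Seq (inc (ptr true)) (emit_ref RSelf)))).

(** * Correctness of the machine *)

Section Correctness.
Variables (w : seq sym) (B : nat).
Let n := size w.
(** Room for raising a counter from [n.+1], the position of the right endmarker, by one. *)
Hypothesis big : n.+2 < 2 ^ B.
Notation tr := (triple (blank_cell reg) w B).
Notation st := (at_regs B).

Lemma inc_tr p r k r' o : p <= n.+1 -> r k <= n.+1 -> upd r k (r k).+1 =1 r' ->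
  tr (st p r o) (inc k) false (st p r' o).
Proof.
move=> lep le E; have lt : (r k).+1 < 2 ^ B by apply: leq_ltn_trans big.
exact: tr_weak (@inc_regP _ w B p r k o lep lt) (fun t h => h) (fun t => at_regs_ext E).
Qed.

Lemma dec_tr p r k r' o : p <= n.+1 -> 0 < r k -> upd r k (r k).-1 =1 r' ->
  tr (st p r o) (dec k) false (st p r' o).
Proof.
by move=> lep gt E; exact: tr_weak (@dec_regP _ w B p r k o lep gt) (fun t h => h) (fun t =>
  at_regs_ext E).
Qed.

Lemma input_tr g p r o b m x p' o' : g (read_input w p) = (b, m, x) ->
  minn (do_move m p) n.+1 = p' ->
  o ++ match x with Some s => [:: s] | None => [::] end = o' ->
  tr (st p r o) (input_act _ g) b (st p' r o').
Proof. by move=> gE <- <-; apply: input_actP. Qed.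

Lemma test_tr f p r o : p <= n.+1 ->
  tr (st p r o) (test f) (f (read_input w p)) (st p r o).
Proof. by move=> lep; apply: (@input_tr _ p r o _ MStay None) => //;
  [apply/minn_idPl|apply: cats0]. Qed.

Lemma out_tr s p r o : p <= n.+1 -> tr (st p r o) (out s) false (st p r (rcons o s)).
Proof. by move=> lep; apply: (@input_tr _ p r o _ MStay (Some s)) => //;
  [apply/minn_idPl|apply: cats1]. Qed.

Lemma right_tr p r o : p <= n -> tr (st p r o) go_right false (st p.+1 r o).
Proof. by move=> lep; apply: (@input_tr _ p r o _ MRight None) => //;
  [apply/minn_idPl|apply: cats0]. Qed.

Lemma ret_tr b p r o : p <= n.+1 -> tr (st p r o) (ret _ b) b (st p r o).
Proof.
move=> lep t [L [h1 h2]].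
have [u e hu] := @at_cell_act _ w B (fun _ a => (b, (a, MStay, MStay, None))) p L 0 o b
  lep (leq0n _) erefl t h1.
by exists u => //; exists L.
Qed.

Lemma while_end k c p r o : p <= n.+1 -> r k = 0 -> tr (st p r o) (While k c) false (st p r o).
Proof.
move=> lep r0; apply: tr_loop_end; apply: (tr_if (nonzeroP k lep)).
by rewrite r0; apply: ret_tr.
Qed.

Lemma while_step k c p r o b p' r' o' Q : p <= n.+1 -> p' <= n.+1 -> 0 < r k ->
  tr (st p r o) c b (st p' r' o') -> tr (st p' r' o') (While k c) false Q ->
  tr (st p r o) (While k c) false Q.
Proof.
move=> lep lep' r0 hc hw; apply: tr_loop_step hw; apply: (tr_if (nonzeroP k lep)).
by rewrite r0; apply: tr_seq hc (ret_tr _ _).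
Qed.

Lemma read_input_cat pre s post : w = pre ++ s :: post -> read_input w (size pre).+1 = Some s.
Proof. by move=> ->; rewrite /=; elim: pre. Qed.

Lemma read_input_lt i : i < n -> read_input w i.+1 = Some (nth SEnd w i).
Proof. by rewrite /= /n; elim: w i => [|s v IH] [|i] //=; apply: IH. Qed.

Lemma read_input_end : read_input w n.+1 = None.
Proof. by rewrite /n /=; elim: w. Qed.


Lemma rewind_tr p r o : p <= n.+1 -> tr (st p r o) rewind_input false (st 0 r o).
Proof.
have left_tr q : q.-1 <= n -> tr (st q r o) go_left false (st q.-1 r o).
  move=> leq; apply: (@input_tr _ q r o _ MLeft None) => //; last exact: cats0.
  by apply/minn_idPl; apply: leqW.
have from q : q.-1 <= n -> tr (st q r o) rewind_input false (st 0 r o).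
  have T0 := @test_tr (fun s => isSome s) 0 r o (leq0n _).
  elim: q => [|[|q] IH] leq.
  - by apply: tr_loop_end; exact: tr_seq (left_tr _ leq) T0.
  - by apply: tr_loop_end; exact: tr_seq (left_tr _ leq) T0.
  - have rs := read_input_lt leq.
    apply: tr_loop_step (IH (ltnW leq)).
    by apply: tr_seq (left_tr _ leq) _; have := @test_tr (fun s => isSome s) q.+1 r o (leqW leq);
      rewrite rs.
by move=> lep; apply: from; case: p lep.
Qed.

Lemma goto_tr b p x y d o : p <= n.+1 -> x <= n.+1 ->
  tr (st p (regs b x y 0 d) o) (goto b) false (st x (regs b x y 0 d) o).
Proof.
move=> lep lex; apply: tr_seq (rewind_tr lep) _.
(* While the pointer runs down, the head position and [tmp] grow in step with it. *)
have loop1 k q t : q + k <= n.+1 -> t + k <= n.+1 ->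
    tr (st q (regs b k y t d) o) (While (ptr b) (Seq (dec (ptr b)) (Seq (inc tmp) go_right)))
      false (st (q + k) (regs b 0 y (t + k) d) o).
  elim: k q t => [|k IH] q t leq let_.
    by rewrite addn0 in leq; rewrite !addn0; apply: while_end; rewrite ?regs_ptr.
  have leq' : q <= n by rewrite -ltnS; apply: leq_trans leq; rewrite addnS ltnS leq_addr.
  have let' : t <= n by rewrite -ltnS; apply: leq_trans let_; rewrite addnS ltnS leq_addr.
  have gt : 0 < regs b k.+1 y t d (ptr b) by rewrite regs_ptr.
  have hc : tr (st q (regs b k.+1 y t d) o) (Seq (dec (ptr b)) (Seq (inc tmp) go_right)) false
               (st q.+1 (regs b k y t.+1 d) o).
    apply: tr_seq (dec_tr (leqW leq') gt _) _; first by rewrite regs_ptr; apply: upd_ptr.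
    by apply: tr_seq (inc_tr (leqW leq') (leqW let') (upd_tmp _ _ _ _ _ _)) (right_tr leq').
  have IH' := IH q.+1 t.+1; rewrite !addSnnS in IH'.
  exact: while_step (leqW leq') (leq' : q.+1 <= n.+1) gt hc (IH' leq let_).
have loop2 k q z : q <= n.+1 -> z + k <= n.+1 ->
    tr (st q (regs b z y k d) o) (While tmp (Seq (dec tmp) (inc (ptr b))))
      false (st q (regs b (z + k) y 0 d) o).
  move=> leq; elim: k z => [|k IH] z lez.
    by rewrite addn0; apply: while_end.
  have lez' : z <= n by rewrite -ltnS; apply: leq_trans lez; rewrite addnS ltnS leq_addr.
  have hc : tr (st q (regs b z y k.+1 d) o) (Seq (dec tmp) (inc (ptr b))) false
               (st q (regs b z.+1 y k d) o).
    apply: tr_seq (dec_tr leq _ (upd_tmp _ _ _ _ _ _)) _ => //.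
    by apply: (inc_tr leq); rewrite regs_ptr; [apply: leqW|apply: upd_ptr].
  rewrite -addSnnS; apply: (while_step leq leq _ hc (IH z.+1 _)) => //.
  by rewrite addSnnS.
by apply: tr_seq (loop1 x 0 0 lex lex) (loop2 x x 0 lex lex).
Qed.
Definition spelled (print : bool) (l : seq sym) : seq sym :=
  if print then map bsym (flatten (map code l)) else [::].

Lemma spelled_cat print l l' : spelled print (l ++ l') = spelled print l ++ spelled print l'.
Proof. by case: print => //=; rewrite map_cat flatten_cat map_cat. Qed.

Definition depth_after (s : sym) (d : nat) : nat :=
  if is_binary s then d.+1 else if is_leaf s then d.-1 else d.

Lemma size_pre_lt pre l post : w = pre ++ l ++ post -> size pre + size l <= n.
Proof. by rewrite /n => ->; rewrite !size_cat leq_add2l leq_addr. Qed.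

Lemma visit_tr print pre s post b x y t d o : w = pre ++ s :: post ->
  0 < d <= n ->
  tr (st (size pre).+1 (regs b x y t d) o) (visit print) false
     (st (size pre).+2 (regs b x y t (depth_after s d)) (o ++ spelled print [:: s])).
Proof.
move=> wE /andP[d0 dn].
have lt : size pre < n by have := @size_pre_lt pre [:: s] post wE; rewrite addn1.
have lep := leqW lt; have rd := read_input_cat wE.
have code_tr i o' : tr (st (size pre).+1 (regs b x y t d) o') (out_code i) false
    (st (size pre).+1 (regs b x y t d) (rcons o' (bsym (nth false (code s) i)))).
  apply: (@input_tr _ _ _ _ _ MStay (Some (bsym (nth false (code s) i)))); first by rewrite rd.
    exact/minn_idPl.
  exact: cats1.
apply: (tr_seq (b1 := false) (Q := st (size pre).+1 (regs b x y t d) (o ++ spelled print [:: s]))).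
  case: print => /=; last by rewrite cats0; apply: ret_tr.
  have -> : o ++ map bsym (code s ++ [::]) = rcons (rcons (rcons o (bsym (nth false (code s) 0)))
      (bsym (nth false (code s) 1))) (bsym (nth false (code s) 2)).
    by rewrite -!cats1 -!catA; case: (s).
  exact: tr_seq (code_tr _ _) (tr_seq (code_tr _ _) (code_tr _ _)).
move: (o ++ spelled print [:: s]) => o'.
pose d1 := if is_binary s then d.+1 else d.
have tst f : tr (st (size pre).+1 (regs b x y t d) o') (test (on_sym f)) (f s)
                (st (size pre).+1 (regs b x y t d) o').
  by have := @test_tr (on_sym f) _ (regs b x y t d) o' lep; rewrite rd.
apply: (tr_seq (b1 := false) (Q := st (size pre).+1 (regs b x y t d1) o')).
  apply: (tr_if (tst is_binary)); rewrite /d1; case: is_binary; last exact: ret_tr.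
  by apply: (inc_tr lep); [apply: leqW | apply: upd_depth].
apply: (tr_seq (b1 := false) (Q := st (size pre).+1 (regs b x y t (depth_after s d)) o'));
  last exact: right_tr.
have leaf_tst := @test_tr (on_sym is_leaf) _ (regs b x y t d1) o' lep; rewrite rd in leaf_tst.
apply: (tr_if leaf_tst).
rewrite /depth_after /d1; case: s {wE rd tst leaf_tst code_tr d1} => /=; try exact: ret_tr.
  by apply: (dec_tr lep) => //; apply: upd_depth.
by apply: (dec_tr lep) => //; apply: upd_depth.
Qed.

(* Stated for an arbitrary continuation [Q] of the loop, so that the induction on [A] can
   chain the scans of its immediate subformulas. *)
Lemma walk print A pre post b x y t d o Q :
  w = pre ++ encode A ++ post -> d + size (encode A) <= n ->
  tr (st (size pre + size (encode A)).+1 (regs b x y t d) (o ++ spelled print (encode A)))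
     (While depth (visit print)) false Q ->
  tr (st (size pre).+1 (regs b x y t d.+1) o) (While depth (visit print)) false Q.
Proof.
have one s pre' post' d' o' : w = pre' ++ s :: post' -> d'.+1 <= n ->
  tr (st (size pre').+2 (regs b x y t (depth_after s d'.+1)) (o' ++ spelled print [:: s]))
     (While depth (visit print)) false Q ->
  tr (st (size pre').+1 (regs b x y t d'.+1) o') (While depth (visit print)) false Q.
  move=> wE le hQ; have := @size_pre_lt pre' [:: s] post' wE; rewrite addn1 => lt.
  exact: while_step (leqW lt) (lt : (size pre').+2 <= n.+1) (isT : 0 < regs b x y t d'.+1 depth)
    (@visit_tr print pre' s post' b x y t d'.+1 o' wE le) hQ.
(* The induction hypotheses are passed as arguments so that the three connectives share one proof.
   The binary symbol adds one pending subformula; the scans of [A1] and [A2] then remove two. *)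
have bin s A1 A2 pre' post' d' o' :
    (forall pre post d o, w = pre ++ encode A1 ++ post -> d + size (encode A1) <= n ->
      tr (st (size pre + size (encode A1)).+1 (regs b x y t d) (o ++ spelled print (encode A1)))
         (While depth (visit print)) false Q ->
      tr (st (size pre).+1 (regs b x y t d.+1) o) (While depth (visit print)) false Q) ->
    (forall pre post d o, w = pre ++ encode A2 ++ post -> d + size (encode A2) <= n ->
      tr (st (size pre + size (encode A2)).+1 (regs b x y t d) (o ++ spelled print (encode A2)))
         (While depth (visit print)) false Q ->
      tr (st (size pre).+1 (regs b x y t d.+1) o) (While depth (visit print)) false Q) ->
    is_binary s ->
    w = pre' ++ (s :: encode A1 ++ encode A2) ++ post' ->
    d' + size (s :: encode A1 ++ encode A2) <= n ->
    tr (st (size pre' + size (s :: encode A1 ++ encode A2)).+1 (regs b x y t d')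
          (o' ++ spelled print (s :: encode A1 ++ encode A2)))
       (While depth (visit print)) false Q ->
    tr (st (size pre').+1 (regs b x y t d'.+1) o') (While depth (visit print)) false Q.
  move=> IH1 IH2 bs wE /= le hQ; rewrite size_cat addnS in le.
  have wE1 : w = rcons pre' s ++ encode A1 ++ encode A2 ++ post' by rewrite wE cat_rcons /= -catA.
  have wE2 : w = (rcons pre' s ++ encode A1) ++ encode A2 ++ post' by rewrite wE1 -catA.
  apply: (one s pre' (encode A1 ++ encode A2 ++ post') d' o'); first by rewrite wE1 cat_rcons.
    by apply: leq_ltn_trans le; rewrite leq_addr.
  rewrite /depth_after bs -(size_rcons pre' s); apply: (IH1 _ _ _ _ wE1).
    by rewrite addSn; apply: leq_ltn_trans le; rewrite leq_add2l leq_addr.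
  rewrite -size_cat; apply: (IH2 _ _ _ _ wE2).
    by apply: ltnW; apply: leq_ltn_trans le; rewrite leq_add2l leq_addl.
  rewrite -cat1s !spelled_cat !catA in hQ.
  by rewrite !size_cat size_rcons addSn; rewrite /= size_cat addnS addnA in hQ.
elim: A pre post d o => [p||A1 IH1 A2 IH2|A1 IH1 A2 IH2|A1 IH1 A2 IH2] pre post d o;
  try exact: bin.
- move=> wE le hQ; rewrite /= in wE le hQ.
  (* Inside a variable the depth stays at [d.+1] until [SEnd] lowers it. *)
  have bits l pre' o' : all is_bit l -> w = pre' ++ l ++ SEnd :: post -> d.+1 <= n ->
      tr (st (size pre' + size l).+2 (regs b x y t d) (o' ++ spelled print (rcons l SEnd)))
         (While depth (visit print)) false Q ->
      tr (st (size pre').+1 (regs b x y t d.+1) o') (While depth (visit print)) false Q.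
    elim: l pre' o' => [|s l IH] pre' o' /=.
      by rewrite addn0 => _ wE' le' h; apply: one wE' le' _.
    move=> /andP[bs al] wE' le' h; apply: (one s _ (l ++ SEnd :: post) _ _ wE' le').
    have -> : depth_after s d.+1 = d.+1 by case: s bs {wE' h}.
    rewrite -(size_rcons pre' s); apply: IH => //; first by rewrite cat_rcons.
    by rewrite -catA -spelled_cat /= size_rcons addSnnS.
  have ltd : d.+1 <= n by apply: leq_trans le; rewrite addnS ltnS leq_addr.
  apply: (one SVar _ ((nat_bits p ++ [:: SEnd]) ++ post) _ _ wE ltd).
  rewrite -(size_rcons pre SVar); apply: (bits (nat_bits p)) => //.
  + exact: all_bit_nat_bits.
  + by rewrite wE cat_rcons -catA.
  + by rewrite -catA -spelled_cat /= size_rcons addSnnS; rewrite cats1 size_rcons addnS in hQ.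
- by move=> wE le; rewrite /= addn1; apply: one wE _; rewrite -addn1.
Qed.

Lemma traverse_tr print A pre post b x y t o : w = pre ++ encode A ++ post ->
  tr (st (size pre).+1 (regs b x y t 0) o) (traverse print) false
     (st (size pre + size (encode A)).+1 (regs b x y t 0) (o ++ spelled print (encode A))).
Proof.
move=> wE; have le := @size_pre_lt _ _ _ wE.
have lep : (size pre).+1 <= n.+1 by apply: leqW; apply: leq_trans le; rewrite -addn1 leq_add2l;
  case: (A).
apply: tr_seq (inc_tr (r' := regs b x y t 1) lep _ (upd_depth _ _ _ _ _ _)) _ => //.
apply: (walk wE); first by rewrite add0n; apply: leq_trans le; rewrite leq_addl.
by apply: while_end.
Qed.

(** The input position is forgotten between commands, since those that read the input begin with a
    [goto]. *)
Definition ready (b : bool) (x y : nat) (o : seq sym) (t : tape (cell reg)) : Prop :=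
  exists p, p <= n.+1 /\ st p (regs b x y 0 0) o t.

Lemma st_ready p b x y o t : p <= n.+1 -> st p (regs b x y 0 0) o t -> ready b x y o t.
Proof. by exists p. Qed.

Lemma ready_tr b x y o c r Q :
  (forall p, p <= n.+1 -> tr (st p (regs b x y 0 0) o) c r Q) -> tr (ready b x y o) c r Q.
Proof. by move=> h t [p [/h]]; apply. Qed.

Lemma to_ready P c r p b x y o : p <= n.+1 ->
  tr P c r (st p (regs b x y 0 0) o) -> tr P c r (ready b x y o).
Proof. by move=> lep h; apply: tr_weak h (fun t h => h) (fun t => st_ready lep). Qed.

Lemma regs_flip b x y t d : regs b x y t d =1 regs (~~ b) y x t d.
Proof. by move=> [[] []]; case: b. Qed.

Lemma goto_ready b i j o : i <= n.+1 -> j <= n.+1 ->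
  tr (ready false i j o) (goto b) false (st (if b then j else i) (regs false i j 0 0) o).
Proof.
move=> lei lej; apply: ready_tr => p lep; case: b; last exact: goto_tr.
apply: tr_weak (@goto_tr true p j i 0 o lep lej) _ _ => t; exact: at_regs_ext (regs_flip _ _ _ _ _).
Qed.

Lemma out_ready s i j o : tr (ready false i j o) (out s) false (ready false i j (rcons o s)).
Proof. by apply: ready_tr => p lep; apply: (to_ready lep); apply: out_tr. Qed.

Lemma ret_ready b i j o : tr (ready false i j o) (ret _ b) b (ready false i j o).
Proof. by apply: ready_tr => p lep; apply: (to_ready lep); apply: ret_tr. Qed.

Definition located (A : form) (i : nat) : Prop :=
  exists2 pre, i = (size pre).+1 & exists post, w = pre ++ encode A ++ post.

Lemma located_le A i : located A i -> i <= n.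
Proof.
move=> [pre -> [post /size_pre_lt le]]; apply: leq_trans le.
by rewrite -addn1 leq_add2l; case: (A).
Qed.

Definition compound (A : form) : bool := is_binary (head SEnd (encode A)).

Lemma located_left A i : compound A -> located A i -> located (left_sub A) i.+1.
Proof.
by case: A => // A1 A2 _ [pre -> [post wE]];
  (* The connective is read off [w] itself, so that one witness serves all three cases. *)
  exists (rcons pre (head SEnd (take 1 (drop (size pre) w)))); rewrite ?size_rcons //;
  exists (encode A2 ++ post);
  rewrite {1}wE {1}wE drop_size_cat // cat_rcons /= -catA.
Qed.

Lemma located_right A i : compound A -> located A i ->
  located (right_sub A) (i.+1 + size (encode (left_sub A))).
Proof.
by case: A => // A1 A2 _ [pre -> [post wE]];
  exists (rcons pre (head SEnd (take 1 (drop (size pre) w))) ++ encode A1);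
  rewrite ?size_cat ?size_rcons //; exists post;
  rewrite {1}wE {1}wE drop_size_cat // -catA cat_rcons /= -catA.
Qed.

Definition for_compound (x : ref) : bool := match x with RLeft | RRight => true | _ => false end.

Lemma locate_tr x A P i j o : located A i -> located P j ->
  (for_compound x -> compound A) ->
  exists2 q, located (deref A P x) q &
    tr (ready false i j o) (locate x) false (st q (regs false i j 0 0) o).
Proof.
move=> locA locP ok; have lei := located_le locA; have lej := located_le locP.
have go b := @goto_ready b i j o (leqW lei) (leqW lej).
case: x ok => /= ok.
- by exists i => //; apply: (go false).
- exists i.+1; first by apply: located_left; rewrite ?ok.
  exact: tr_seq (go false) (right_tr lei).
- exists (i.+1 + size (encode (left_sub A))); first by apply: located_right; rewrite ?ok.
  apply: tr_seq (go false) (tr_seq (right_tr lei) _).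
  have [pre -> [post wE]] := located_left (ok isT) locA.
  by have := @traverse_tr false (left_sub A) pre post false i j 0 o wE; rewrite cats0.
- by exists j => //; apply: (go true).
Qed.

Lemma emit_ref_tr x A P i j o : located A i -> located P j ->
  (for_compound x -> compound A) ->
  tr (ready false i j o) (emit_ref x) false (ready false i j (o ++ encode (Var (name (deref A P
    x))))).
Proof.
move=> locA locP ok; have [q locq h] := locate_tr o locA locP ok.
have leq := leqW (located_le locq); have [pre qE [post wE]] := locq.
apply: tr_seq h (tr_seq (out_tr _ leq) (tr_seq (out_tr _ leq) _)).
have := @traverse_tr true _ pre post false i j 0 (rcons (rcons o SVar) S1) wE; rewrite -qE => h.
have le' : (size pre + size (encode (deref A P x))).+1 <= n.+1 := size_pre_lt wE.
apply: tr_seq h _; apply: (to_ready le').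
have -> : o ++ encode (Var (name (deref A P x))) =
    rcons (rcons (rcons o SVar) S1 ++ spelled true (encode (deref A P x))) SEnd.
  by rewrite /= nat_bits_name !cat_rcons -cats1 -catA.
exact: out_tr.
Qed.

Fixpoint uses_children (t : tform) : bool :=
  match t with
  | TRef x => for_compound x
  | TImp t u => uses_children t || uses_children u
  end.

Lemma emit_tr t A P i j o : located A i -> located P j ->
  (uses_children t -> compound A) ->
  tr (ready false i j o) (emit t) false (ready false i j (o ++ iencode (inst A P t))).
Proof.
move=> locA locP; elim: t o => [x|t IHt u IHu] o /= ok; first exact: emit_ref_tr.
apply: (tr_seq (@out_ready SImp i j o)); apply: tr_seq (IHt _ _) _; first by move=> h; apply: ok;
  rewrite h.
have := IHu (rcons o SImp ++ iencode (inst A P t)); rewrite cat_rcons -catA; apply.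
by move=> h; apply: ok; rewrite h orbT.
Qed.

(** In prefix notation an iterated implication is the list of its premises, each preceded by [SImp],
    followed by the conclusion. *)
Definition as_premise (C : iform) : seq sym := SImp :: iencode C.

Lemma emit_schemas_tr ts A P i j o : located A i -> located P j ->
  (has uses_children ts -> compound A) ->
  tr (ready false i j o) (emit_schemas ts) false
     (ready false i j (o ++ flatten (map as_premise (map (inst A P) ts)))).
Proof.
move=> locA locP; elim: ts o => [|t ts IH] o /= ok; first by rewrite cats0; apply: ret_ready.
apply: (tr_seq (@out_ready SImp i j o)); apply: tr_seq (emit_tr locA locP _) _.
  by move=> h; apply: ok; rewrite h.
have := IH (rcons o SImp ++ iencode (inst A P t)); rewrite cat_rcons -catA; apply.
by move=> h; apply: ok; rewrite h orbT.
Qed.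

Lemma located_read A i : located A i -> read_input w i = Some (head SEnd (encode A)).
Proof.
move=> [pre -> [post wE]]; apply: (read_input_cat (post := behead (encode A) ++ post)).
by rewrite wE; case: (A).
Qed.

Lemma emit_if_skip s s' i j o : i <= n -> j <= n -> read_input w i = Some s' ->
  code s' == code s = false -> tr (ready false i j o) (emit_if s) false (ready false i j o).
Proof.
move=> lei lej rd ne; apply: (tr_seq (@goto_ready false i j o (leqW lei) (leqW lej))).
have := @test_tr (on_sym (fun x => code x == code s)) i (regs false i j 0 0) o (leqW lei).
rewrite rd /= ne => h; apply: (tr_if h).
by apply: (to_ready (leqW lei)); apply: ret_tr; apply: leqW.
Qed.

Definition premises (A P : form) : seq sym := flatten (map as_premise (clauses_of A P)).

Lemma emit_if_tr s A P i j o : located A i -> located P j -> head SEnd (encode A) = s ->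
  tr (ready false i j o) (emit_if s) false (ready false i j (o ++ premises A P)).
Proof.
move=> locA locP <-; have lei := leqW (located_le locA).
apply: (tr_seq (@goto_ready false i j o lei (leqW (located_le locP)))).
have := @test_tr (on_sym (fun x => code x == code (head SEnd (encode A)))) i (regs false i j 0 0)
  o lei.
rewrite (located_read locA) /= eqxx => h; apply: (tr_if h).
apply: (tr_weak (@emit_schemas_tr (schemas (head SEnd (encode A))) A P i j o locA locP _) _ (fun t
  h => h)).
  by case: (A).
by move=> t; apply: (st_ready lei).
Qed.

(** [None] stands for the positions of a variable's code after its [SVar], where no subformula
    starts. *)
Definition labels (x : option form) (i : nat) : Prop :=
  match x with
  | Some A => located A i
  | None => i <= n /\ exists2 s, read_input w i = Some s & ~~ is_start s
  end.

Lemma labels_le x i : labels x i -> i <= n.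
Proof. by case: x => [A|[]] //; apply: located_le. Qed.

Definition opt_premises (x y : option form) : seq sym :=
  if x is Some A then if y is Some P then premises A P else [::] else [::].

Lemma emit_pair_tr x y i j o : labels x i -> labels y j ->
  tr (ready false i j o) emit_pair false (ready false i j (o ++ opt_premises x y)).
Proof.
move=> lx ly; have lei := labels_le lx; have lej := labels_le ly.
apply: (tr_seq (@goto_ready true i j o (leqW lei) (leqW lej))).
have := @test_tr (on_sym is_start) j (regs false i j 0 0) o (leqW lej).
case: y ly => [P|] ly; last first.
  have [_ [s -> /= /negPf ->]] := ly; have -> : opt_premises x None = [::] by case: x {lx}.
  rewrite cats0 => h; apply: (tr_if h).
  by apply: (to_ready (leqW lej)); apply: ret_tr; apply: leqW.
rewrite (located_read ly) /=; have -> : is_start (head SEnd (encode P)) by case: (P).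
move=> h; apply: (tr_if h) => /=.
apply: (tr_weak (P := ready false i j o)) _ _ (fun t h => h); last first.
  by move=> t; apply: st_ready; apply: leqW.
have go s s' o1 : read_input w i = Some s' -> code s' == code s = false ->
    tr (ready false i j o1) (emit_if s) false (ready false i j o1).
  by move=> rd ne; apply: emit_if_skip rd ne.
(* At most one of the four tests prints; the choice of the intermediate outputs below says which. *)
have all4 o1 o2 o3 o4 :
    tr (ready false i j o) (emit_if SImp) false (ready false i j o1) ->
    tr (ready false i j o1) (emit_if SAnd) false (ready false i j o2) ->
    tr (ready false i j o2) (emit_if SOr) false (ready false i j o3) ->
    tr (ready false i j o3) (emit_if SBot) false (ready false i j o4) ->
    tr (ready false i j o) (Seq (emit_if SImp) (Seq (emit_if SAnd) (Seq (emit_if SOr) (emit_if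
      SBot))))
      false (ready false i j o4).
  by move=> h1 h2 h3 h4; exact: tr_seq h1 (tr_seq h2 (tr_seq h3 h4)).
case: x lx => [A|] lx /=; last first.
  have [_ [s rd ns]] := lx; rewrite cats0.
  by apply: (all4 o o o); apply: go rd _; case: (s) ns.
have rd := located_read lx.
case: A lx rd => [p||A1 A2|A1 A2|A1 A2] lx rd; have em s o1 := @emit_if_tr s _ P i j o1 lx ly.
- by rewrite cats0; apply: (all4 o o o); apply: go rd _.
- by apply: (all4 o o o); try (by apply: go rd _); apply: em.
- by set o4 := o ++ _; apply: (all4 o4 o4 o4); try (by apply: go rd _); apply: em.
- by set o4 := o ++ _; apply: (all4 o o4 o4); try (by apply: go rd _); apply: em.
- by set o4 := o ++ _; apply: (all4 o o o4); try (by apply: go rd _); apply: em.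
Qed.

Lemma ready_flip b x y o t : ready b x y o t -> ready (~~ b) y x o t.
Proof. by move=> [p [lep h]]; exists p; split=> //; apply: at_regs_ext h; apply: regs_flip. Qed.

Lemma inc_ready b x y o : x <= n.+1 -> tr (ready b x y o) (inc (ptr b)) false (ready b x.+1 y o).
Proof.
move=> lex; apply: ready_tr => p lep; apply: (to_ready lep).
by apply: (inc_tr lep); rewrite regs_ptr //; apply: upd_ptr.
Qed.

Lemma clear_ready b x y o :
  tr (ready b x y o) (While (ptr b) (dec (ptr b))) false (ready b 0 y o).
Proof.
apply: ready_tr => p lep; apply: (to_ready lep).
elim: x => [|x IH]; first by apply: while_end; rewrite ?regs_ptr.
have gt : 0 < regs b x.+1 y 0 0 (ptr b) by rewrite regs_ptr.
apply: (while_step lep lep gt _ IH).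
by apply: (dec_tr lep gt); rewrite regs_ptr; apply: upd_ptr.
Qed.

(** Rounds are counted from 0 by [g], whereas the pointer holds [k.+1] in round [k]. *)
Lemma For_tr b c y o (g : nat -> seq sym) :
  (forall k o', k < n -> tr (ready b k.+1 y o') c false (ready b k.+1 y (o' ++ g k))) ->
  tr (ready b 0 y o) (For b c) false (ready b 0 y (o ++ flatten (map g (iota 0 n)))).
Proof.
move=> body; apply: (tr_seq (@inc_ready b 0 y o isT)).
apply: tr_seq (@clear_ready b n.+1 y _).
have go k o' : k <= n -> tr (ready b k.+1 y o') (goto b) false (st k.+1 (regs b k.+1 y 0 0) o').
  by move=> lek; apply: ready_tr => p lep; apply: goto_tr.
have loop m k o' : k + m = n ->
    tr (ready b k.+1 y o')
       (Loop (Seq (goto b) (If (test (fun s => isSome s)) (Seq c (Seq (inc (ptr b)) (ret _ true)))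
         (ret _ false))))
       false (ready b n.+1 y (o' ++ flatten (map g (iota k m)))).
  elim: m k o' => [|m IH] k o' km.
    rewrite addn0 in km; rewrite km cats0; apply: tr_loop_end.
    apply: (tr_seq (go n o' (leqnn _))).
    have := @test_tr (fun s => isSome s) n.+1 (regs b n.+1 y 0 0) o' (leqnn _).
    rewrite read_input_end => h; apply: (tr_if h).
    by apply: (@to_ready _ _ _ n.+1); [|apply: ret_tr].
  have ltk : k < n by rewrite -km -addSnnS leq_addr.
  rewrite /= catA; apply: tr_loop_step (IH k.+1 (o' ++ g k) _); last by rewrite addSnnS.
  apply: (tr_seq (go k o' (ltnW ltk))).
  have := @test_tr (fun s => isSome s) k.+1 (regs b k.+1 y 0 0) o' (leqW ltk).
  rewrite (read_input_lt ltk) => h; apply: (tr_if h) => /=.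
  have {}body := tr_weak (body k o' ltk) (fun t => @st_ready k.+1 b _ y o' t (leqW ltk)) (fun t h
    => h).
  apply: (tr_seq body); apply: (tr_seq (@inc_ready b k.+1 y _ (leqW ltk))).
  by apply: ready_tr => p lep; apply: (to_ready lep); apply: ret_tr.
exact: loop.
Qed.

(* For each symbol of [encode A], the subformula whose code starts there, if any. *)
Fixpoint heads (A : form) : seq (option form) :=
  match A with
  | Var p => Some A :: nseq (size (nat_bits p)).+1 None
  | Bot => [:: Some A]
  | Imp B C | And B C | Or B C => Some A :: heads B ++ heads C
  end.

Lemma size_heads A : size (heads A) = size (encode A).
Proof.
by elim: A => //= [p|A IHA C IHC|A IHA C IHC|A IHA C IHC];
  rewrite size_cat ?size_nseq ?IHA ?IHC ?size_cat ?addn1.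
Qed.

(** Ordered by their first symbols the subformulas form exactly [subs], repetitions included, so the
    machine lists the clauses in the order of [reduce]. *)
Lemma pmap_heads A : pmap id (heads A) = subs A.
Proof.
elim: A => [p||A IHA C IHC|A IHA C IHC|A IHA C IHC] //=; try by rewrite pmap_cat IHA IHC.
by congr cons; elim: (size _).
Qed.

Lemma heads_labels A pre post k : w = pre ++ encode A ++ post -> k < size (encode A) ->
  labels (nth None (heads A) k) (size pre + k).+1.
Proof.
have bin s A1 A2 pre' post' k' :
    (forall pre post k, w = pre ++ encode A1 ++ post -> k < size (encode A1) ->
      labels (nth None (heads A1) k) (size pre + k).+1) ->
    (forall pre post k, w = pre ++ encode A2 ++ post -> k < size (encode A2) ->
      labels (nth None (heads A2) k) (size pre + k).+1) ->
    w = pre' ++ s :: encode A1 ++ encode A2 ++ post' -> k' < size (encode A1) + size (encode A2) ->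
    labels (nth None (heads A1 ++ heads A2) k') (size pre' + k'.+1).+1.
  move=> IH1 IH2 wE lt; rewrite nth_cat size_heads.
  have E : w = rcons pre' s ++ encode A1 ++ encode A2 ++ post' by rewrite wE cat_rcons.
  case: ltnP => [lt1|ge1].
    by have := IH1 _ _ _ E lt1; rewrite size_rcons addSnnS.
  rewrite catA in E; have := IH2 _ _ (k' - size (encode A1)) E.
  rewrite size_cat size_rcons -addnA subnKC // addSnnS; apply.
  by rewrite -(ltn_add2l (size (encode A1))) subnKC.
elim: A pre post k => [p||A1 IH1 A2 IH2|A1 IH1 A2 IH2|A1 IH1 A2 IH2] pre post [|k] wE lt;
  try (by rewrite addn0; exists pre => //; exists post); try (by []);
  try (by apply: (bin _ _ _ _ _ _ IH1 IH2); [rewrite wE /= -catA | move: lt; rewrite /= size_cat]).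
have -> : nth None (heads (Var p)) k.+1 = None.
  by rewrite -[LHS]/(nth None (nseq (size (nat_bits p)).+1 None) k) nth_nseq if_same.
move: lt; rewrite /= ltnS => lt.
have lti : size pre + k.+1 < n.
  by apply: leq_trans (size_pre_lt wE); rewrite -addnS leq_add2l.
split=> //; exists (nth SEnd w (size pre + k.+1)); first exact: read_input_lt.
rewrite wE nth_cat ltnNge leq_addr /= addKn /= nth_cat lt.
rewrite nth_cat; case: ltnP => [lk|_]; last by case: (k - _) => [|[|?]].
by have /(all_nthP SEnd)/(_ _ lk) := all_bit_nat_bits p; case: (nth _ _ _).
Qed.

Lemma main_tr phi : w = encode phi ->
  exists2 u, exec (blank_cell reg) w B main (Tape 0 [::] 0 [::]) false u &
    t_out u = flatten (map as_premise (clauses phi)) ++ encode (Var (name phi)).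
Proof.
move=> wE; pose lab := nth None (heads phi).
have wE' : w = [::] ++ encode phi ++ [::] by rewrite cats0.
have labP k : k < n -> labels (lab k) k.+1.
  by move=> lt; apply: (heads_labels wE'); rewrite -wE.
have loc1 : located phi 1 by exists [::] => //; exists [::].
pose row x := flatten (map (fun l => opt_premises x (lab l)) (iota 0 n)).
have inner k o : k < n ->
    tr (ready false k.+1 0 o) (For true emit_pair) false (ready false k.+1 0 (o ++ row (lab k))).
  move=> ltk; have body l o' : l < n -> tr (ready true l.+1 k.+1 o') emit_pair false
      (ready true l.+1 k.+1 (o' ++ opt_premises (lab k) (lab l))).
    move=> ltl; apply: tr_weak (emit_pair_tr (labP k ltk) (labP l ltl)) _ _ => t; exact: ready_flip.
  by apply: tr_weak (@For_tr true emit_pair k.+1 o _ body) _ _ => t; apply: ready_flip.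
have start_tr : tr (eq (Tape 0 [::] 0 [::])) (mark _) false (ready false 0 0 [::]).
  apply: (tr_weak (@markP reg w B) (fun t h => h)) => t h; exists 0; split=> //.
  by apply: at_regs_ext h; case=> [[] []].
have incj : tr (ready false 1 0 (flatten (map (fun k => row (lab k)) (iota 0 n)))) (inc (ptr true))
    false (ready false 1 1 (flatten (map (fun k => row (lab k)) (iota 0 n)))).
  by apply: (tr_weak (@inc_ready true 0 1 _ isT)) => t; apply: ready_flip.
have name_tr := @emit_ref_tr RSelf phi phi 1 1 (flatten (map (fun k => row (lab k)) (iota 0 n)))
  loc1 loc1 (fun h => match notF h with end).
have whole := tr_seq start_tr (tr_seq (@For_tr false _ 0 [::] _ inner)
  (tr_seq (@inc_ready false 0 0 _ isT) (tr_seq incj name_tr))).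
have [u e [q [_ [L [[_ _ _ outE] _]]]]] := whole _ erefl; exists u => //; rewrite outE.
congr cat; rewrite -/(deref _ _ _) /clauses -pmap_heads.
have nE : n = size (heads phi) by rewrite size_heads /n wE.
(* Positions labelled [None] contribute nothing, so a loop over positions amounts to a loop over
   subformulas. *)
have iotaE (h : option form -> seq sym) : h None = [::] ->
    flatten (map (fun k => h (lab k)) (iota 0 n)) =
    flatten (map (fun A => h (Some A)) (pmap id (heads phi))).
  move=> h0; rewrite nE (map_comp h) map_nth_iota0 // take_size.
  by elim: (heads phi) => //= -[A|] l IH /=; rewrite ?h0 IH.
rewrite iotaE; last by rewrite /row; elim: (iota 0 n).
have ff (ll : seq (seq iform)) :
    flatten (map as_premise (flatten ll)) = flatten (map (fun l => flatten (map as_premise l)) ll).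
  by elim: ll => //= l ll IH; rewrite map_cat flatten_cat IH.
rewrite ff -map_comp; congr flatten; apply: eq_map => A.
by rewrite /row iotaE //= ff -map_comp.
Qed.

End Correctness.

(** * Logarithmic space and the final theorem *)

Lemma iencode_reduce phi :
  iencode (reduce phi) = flatten (map as_premise (clauses phi)) ++ encode (Var (name phi)).
Proof.
rewrite /reduce; elim: (clauses phi) => //= C Cs IH.
by rewrite -catA -IH.
Qed.

Lemma reduce_logspace : logspace_reduction reduce.
Proof.
exists (machine (blank_cell reg) main), 3 => phi; set w := encode phi.
(* [trunc_log] rounds down, so [(size w).+2] is below 2 to the power of the logarithm plus one; the
   logarithm is at least 1, hence three times it is large enough. *)
pose B := 3 * trunc_log 2 (size w).+2.
have big : (size w).+2 < 2 ^ B.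
  have := trunc_log_ltn (size w).+2 (isT : 1 < 2) => /leq_trans; apply.
  rewrite leq_exp2l // /B; have : 0 < trunc_log 2 (size w).+2 by rewrite trunc_log_gt0.
  by case: (trunc_log _ _) => // m _; rewrite -addn2 mulnS addnC leq_add // leq_pmull.
have [u e outE] := main_tr big (erefl : w = encode phi).
by have := exec_computes e; rewrite outE -iencode_reduce.
Qed.

Theorem theorem3p12 :
  exists f : form -> iform,
    logspace_reduction f /\
    (forall phi : form,
        iorder (f phi) <= 3 /\ (iprovable (f phi) <-> provable phi)).
Proof.
exists reduce; split; first exact: reduce_logspace.
move=> phi; split; first exact: reduce_order.
by split; [apply: reduce_sound | apply: reduce_complete].
Qed.
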